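(* Assume Ostaszewski's $\clubsuit$-principle. Then $CA^\rho$ holds: (i) for every $n\geq2$ and every good type $\tau=\langle m_k,n_{k+1},r_{k+1}\rangle_{k\in\omega}$ with $n_k\geq n$ for all $k\geq1$, there is an $n$-$\rho$-capturing construction scheme of type $\tau$ over $\omega_1$; and (ii) for every good type $\tau$ for which $\langle n_{k+1}\rangle_{k\in\omega}$ is non-decreasing and unbounded, there is a $\rho$-capturing construction scheme of type $\tau$ over $\omega_1$.
   Context: $\clubsuit$: there is a sequence $\langle C_\delta:\delta\in\mathrm{Lim}\rangle$ ($\mathrm{Lim}$ = nonzero countable limit ordinals) with $C_\delta\subseteq\delta$ of order type $\omega$, $\sup C_\delta=\delta$, such that for every uncountable $S\subseteq\omega_1$ the set $\{\delta:C_\delta\subseteq S\}$ is stationary. A type is a sequence $\tau=\langle m_k,n_{k+1},r_{k+1}\rangle_{k\in\omega}$ of natural numbers with $m_0=1$ and, for all $k$, $n_{k+1}\geq2$, $m_k>r_{k+1}$, $m_{k+1}=r_{k+1}+(m_k-r_{k+1})n_{k+1}$; it is good if every $r\in\omega$ equals $r_k$ for infinitely many $k\geq1$. $A<B$ means every element of $A$ is below every element of $B$; $D(a)$ is the $a$-th element of a finite set of ordinals $D$. A construction scheme of type $\tau$ over a set of ordinals $Y$ is a family $\mathcal{F}$ of nonempty finite subsets of $Y$, cofinal among finite subsets of $Y$ under $\subseteq$, each member of size $m_k$ for some $k$, such that with $\mathcal{F}_k=\{F\in\mathcal{F}:|F|=m_k\}$: (i) for $E,F\in\mathcal{F}_k$,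 $E\cap F$ is an initial segment of both; (ii) every $F\in\mathcal{F}_{k+1}$ equals $F_0\cup\dots\cup F_{n_{k+1}-1}$ with $F_i\in\mathcal{F}_k$ a $\Delta$-system with root $R(F)$, $|R(F)|=r_{k+1}$, $R(F)<F_0\setminus R(F)<\dots<F_{n_{k+1}-1}\setminus R(F)$ (unique decomposition). $\rho(\alpha,\beta)=\min\{k:\exists F\in\mathcal{F}_k\ \{\alpha,\beta\}\subseteq F\}$. For $k\geq1$, $\Xi_\alpha(k)=-1$ if $\alpha\in R(F)$, $=i$ if $\alpha\in F_i\setminus R(F)$, for any $F\in\mathcal{F}_k$ with $\alpha\in F$ (independent of $F$). A root-tail-tail $\Delta$-system is a sequence $\langle D_i\rangle_{i<n}$, $n\geq2$, of finite sets of ordinals of common size $m$ with pairwise intersections $R$, $R<D_i\setminus R$, and $D_0\setminus R<\dots<D_{n-1}\setminus R$; $r=|R|$. It is $\rho$-captured at level $l\geq1$ if $n\leq n_l$ and (I) for all $i<n$, $a<m$: $\Xi_{D_i(a)}(l)=-1$ if $a<r$ and $=i$ if $a\geq r$; (II) $\rho(D_i(a),D_j(a))=l$ for $i<j<n$, $r\leq a<m$. A scheme over $\omega_1$ is $n$-$\rho$-capturing if for every uncountable family $\mathcal{S}$ of nonempty finite subsets of $\omega_1$ there are infinitely many $l$ for which some $n$ distinct members of $\mathcal{S}$, suitably enumerated, form a root-tail-tail $\Delta$-system $\rho$-captured at level $l$; it is $\rho$-capturing if it is $n$-$\rho$-capturing for all $n\geq2$. *)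

(* Defs.v *)
From Stdlib Require Import List Arith Sorted.
Import ListNotations.
Set Implicit Arguments.

(** omega_1 is represented by an abstract strictly well-ordered type (T, lt)
    which is uncountable but all of whose proper initial segments are
    countable; such a well-order is unique up to isomorphism (= omega_1). *)
Record omega1 (T : Type) (lt : T -> T -> Prop) : Prop := {
  o_irrefl : forall x, ~ lt x x;
  o_trans : forall x y z, lt x y -> lt y z -> lt x z;
  o_total : forall x y, lt x y \/ x = y \/ lt y x;
  o_wf : well_founded lt;
  o_uncountable : ~ exists f : T -> nat, forall x y, f x = f y -> x = y;
  o_segments : forall x, exists f : T -> nat,
      forall y z, lt y x -> lt z x -> f y = f z -> y = z }.

Definition countable_set (A : Type) (P : A -> Prop) : Prop :=
  exists f : A -> nat, forall x y, P x -> P y -> f x = f y -> x = y.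

Definition is_limit (T : Type) (lt : T -> T -> Prop) (d : T) : Prop :=
  (exists y, lt y d) /\ forall y, lt y d -> exists z, lt y z /\ lt z d.

Definition club (T : Type) (lt : T -> T -> Prop) (C : T -> Prop) : Prop :=
  (forall x, exists c, C c /\ lt x c) /\
  (forall d, is_limit lt d ->
     (forall y, lt y d -> exists c, C c /\ lt y c /\ lt c d) -> C d).

Definition stationary (T : Type) (lt : T -> T -> Prop) (P : T -> Prop) : Prop :=
  forall C, club lt C -> exists d, P d /\ C d.

(** Ostaszewski's clubsuit; C_delta is given as a strictly increasing
    omega-sequence (i.e. a subset of delta of order type omega) cofinal in delta. *)
Definition clubsuit (T : Type) (lt : T -> T -> Prop) : Prop :=
  exists Cs : T -> nat -> T,
    (forall d, is_limit lt d ->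
       (forall k, lt (Cs d k) (Cs d (S k))) /\
       (forall k, lt (Cs d k) d) /\
       (forall y, lt y d -> exists k, lt y (Cs d k))) /\
    (forall P : T -> Prop, ~ countable_set P ->
       stationary lt (fun d => is_limit lt d /\ forall k, P (Cs d k))).

(** A type tau = <m_k, n_{k+1}, r_{k+1}>; the values tn 0 and tr 0 are unused. *)
Record type_seq := { tm : nat -> nat; tn : nat -> nat; tr : nat -> nat }.

Definition is_type (tau : type_seq) : Prop :=
  tm tau 0 = 1 /\
  forall k, 2 <= tn tau (S k) /\ tr tau (S k) < tm tau k /\
    tm tau (S k) = tr tau (S k) + (tm tau k - tr tau (S k)) * tn tau (S k).

Definition good_type (tau : type_seq) : Prop :=
  is_type tau /\
  forall x N, exists k, N <= k /\ 1 <= k /\ tr tau k = x.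

(** Finite sets of ordinals are represented by strictly increasing lists;
    D(a) is [nth_error D a]. *)

Definition level (T : Type) (tau : type_seq) (F : list T -> Prop) (k : nat)
  (s : list T) : Prop := F s /\ length s = tm tau k.

Definition rtt (T : Type) (lt : T -> T -> Prop) (D : nat -> list T) (nn : nat)
  (R : list T) (mm : nat) : Prop :=
  2 <= nn /\ NoDup R /\
  (forall i, i < nn -> length (D i) = mm) /\
  (forall i j, i < j -> j < nn -> forall x, (In x (D i) /\ In x (D j)) <-> In x R) /\
  (forall i, i < nn -> forall x y, In x R -> In y (D i) -> ~ In y R -> lt x y) /\
  (forall i j, i < j -> j < nn -> forall x y,
      In x (D i) -> ~ In x R -> In y (D j) -> ~ In y R -> lt x y).

Definition decomp (T : Type) (lt : T -> T -> Prop) (tau : type_seq)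
  (F : list T -> Prop) (l : nat) (s : list T) (blocks : nat -> list T)
  (R : list T) : Prop :=
  rtt lt blocks (tn tau l) R (tm tau (l - 1)) /\
  length R = tr tau l /\
  (forall i, i < tn tau l -> level tau F (l - 1) (blocks i)) /\
  (forall x, In x s <-> exists i, i < tn tau l /\ In x (blocks i)).

Definition scheme (T : Type) (lt : T -> T -> Prop) (tau : type_seq)
  (F : list T -> Prop) : Prop :=
  (forall s, F s -> s <> [] /\ StronglySorted lt s) /\
  (forall A : list T, exists s, F s /\ incl A s) /\
  (forall s, F s -> exists k, length s = tm tau k) /\
  (forall k E G, level tau F k E -> level tau F k G ->
     forall x y, In x E -> In x G ->
       (In y E -> lt y x -> In y G) /\ (In y G -> lt y x -> In y E)) /\
  (forall k s, level tau F (S k) s ->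
     exists blocks R, decomp lt tau F (S k) s blocks R).

Definition rho_is (T : Type) (tau : type_seq) (F : list T -> Prop)
  (x y : T) (k : nat) : Prop :=
  (exists s, level tau F k s /\ In x s /\ In y s) /\
  forall k', k' < k -> ~ exists s, level tau F k' s /\ In x s /\ In y s.

(** Xi_x(l) = v, where None encodes -1 and Some i encodes i *)
Definition Xi_is (T : Type) (lt : T -> T -> Prop) (tau : type_seq)
  (F : list T -> Prop) (x : T) (l : nat) (v : option nat) : Prop :=
  forall s blocks R, level tau F l s -> In x s -> decomp lt tau F l s blocks R ->
    match v with
    | None => In x R
    | Some i => i < tn tau l /\ In x (blocks i) /\ ~ In x R
    end.

Definition captured (T : Type) (lt : T -> T -> Prop) (tau : type_seq)
  (F : list T -> Prop) (D : nat -> list T) (nn l : nat) : Prop :=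
  1 <= l /\ nn <= tn tau l /\
  exists R mm, rtt lt D nn R mm /\
    (forall i a x, i < nn -> a < mm -> nth_error (D i) a = Some x ->
        (a < length R -> Xi_is lt tau F x l None) /\
        (length R <= a -> Xi_is lt tau F x l (Some i))) /\
    (forall i j a x y, i < j -> j < nn -> length R <= a -> a < mm ->
        nth_error (D i) a = Some x -> nth_error (D j) a = Some y ->
        rho_is tau F x y l).

Definition n_rho_capturing (T : Type) (lt : T -> T -> Prop) (tau : type_seq)
  (F : list T -> Prop) (nn : nat) : Prop :=
  forall P : list T -> Prop,
    (forall s, P s -> s <> [] /\ StronglySorted lt s) ->
    ~ countable_set P ->
    forall N, exists l, N <= l /\
      exists D : nat -> list T,
        (forall i, i < nn -> P (D i)) /\
        (forall i j, i < j -> j < nn -> D i <> D j) /\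
        captured lt tau F D nn l.

Definition rho_capturing (T : Type) (lt : T -> T -> Prop) (tau : type_seq)
  (F : list T -> Prop) : Prop :=
  forall nn, 2 <= nn -> n_rho_capturing lt tau F nn.

(* Main.v *)
(** Put [A x k = {y < x : rho(y, x) <= k}], listed downwards. A scheme amounts to a family of such rows:
    each [A x k] is empty or [y :: A y k], and [A x k] is the projection of [A x (S k)], which keeps the
    root and the block under construction. The rows are built by recursion on [x]. At a limit [d] the row
    is a generic path through the countable set of states [(k, y :: A y k)], [y < d], where besides
    cofinality it meets capturing requirements. Say that [d] captures [b] blocks with root [R] if above
    every state [s] below [d] there is a level [S L] with root containing [s] and [R] at which [d] lies in
    block [b] and the blocks [0 .. b - 1] contain the tails of members of the given uncountable family.
    Let clubsuit guess, cofinally in [d], ordinals coding pairs [(D, g)] with [g] capturing [b] blocks and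
    the tail of [D] above [g]. Then that tail lies in the block of [g], and the path to [d] can be led into
    the next block: it waits, without changing its state, for a level at which the state has the size of
    the root (here the type has to be good), jumps there to a block above the tail, and enters level [S L] with
    it. Quantifying over all states, and not only over those on the path of [g], is what lets the paths
    of [g] and [d] meet. Hence [b + 1] blocks are captured at [d]. After [n - 1] steps, a member of the
    family with tail above [d] supplies the last block. *)
Require Import Defs.
From Stdlib Require Import List Arith Sorted Lia Classical ClassicalEpsilon FunctionalExtensionality Cantor.
Import ListNotations.
Set Implicit Arguments.

(** * Types and projections *)

Definition rt (tau : type_seq) (k : nat) : nat := tr tau (S k).
Definition nb (tau : type_seq) (k : nat) : nat := tn tau (S k).
Definition tl (tau : type_seq) (k : nat) : nat := tm tau k - rt tau k.

(* A member of level [k + 1] cut down at the element above the list [s] of its predecessors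
   (top first): the root together with the part of [s] that lies in the same block. *)
Definition pr (T : Type) (tau : type_seq) (k : nat) (s : list T) : list T :=
  firstn ((length s - rt tau k) mod tl tau k) s ++ skipn (length s - rt tau k) s.

(** Composite of the projections from level [k'] down to level [k]; if [k' <= k] the list is left
    unchanged. *)
Fixpoint dn (T : Type) (tau : type_seq) (k' k : nat) (s : list T) : list T :=
  match k' with
  | 0 => s
  | S j => if k <=? j then dn tau j k (pr tau j s) else s
  end.

Section Types.
Variable tau : type_seq.
Hypothesis Htau : is_type tau.

Lemma tm_0 : tm tau 0 = 1.
Proof. exact (proj1 Htau). Qed.

Lemma nb_ge2 k : 2 <= nb tau k.
Proof. exact (proj1 (proj2 Htau k)). Qed.

Lemma rt_lt k : rt tau k < tm tau k.
Proof. exact (proj1 (proj2 (proj2 Htau k))). Qed.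

Lemma tm_S k : tm tau (S k) = rt tau k + tl tau k * nb tau k.
Proof. exact (proj2 (proj2 (proj2 Htau k))). Qed.

Lemma tm_split k : tm tau k = rt tau k + tl tau k /\ 0 < tl tau k.
Proof. pose proof (rt_lt k). unfold tl. lia. Qed.

Lemma tm_lt_S k : tm tau k < tm tau (S k).
Proof.
  pose proof (tm_S k). pose proof (tm_split k). pose proof (nb_ge2 k). nia.
Qed.

Lemma tm_lt i j : i < j -> tm tau i < tm tau j.
Proof.
  induction 1 as [|j _ IH]; [apply tm_lt_S|]. pose proof (tm_lt_S j). lia.
Qed.

Lemma tm_le i j : i <= j -> tm tau i <= tm tau j.
Proof.
  intros H. destruct (Nat.eq_dec i j) as [->|]; [lia|]. pose proof (@tm_lt i j). lia.
Qed.

Lemma tm_inj i j : tm tau i = tm tau j -> i = j.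
Proof.
  intros H. destruct (lt_eq_lt_dec i j) as [[h|h]|h]; auto;
  apply tm_lt in h; lia.
Qed.

Lemma tm_gt k : k < tm tau k.
Proof.
  induction k as [|k IH]; [rewrite tm_0; lia|]. pose proof (tm_lt_S k). lia.
Qed.

Section Proj.
Variable T : Type.
Implicit Types s u v : list T.

Lemma pr_small k s : length s < tm tau k -> pr tau k s = s.
Proof.
  intros H. unfold pr. destruct (tm_split k) as [H1 H2].
  rewrite Nat.mod_small by lia. apply firstn_skipn.
Qed.

Lemma pr_length k s : rt tau k <= length s ->
  length (pr tau k s) = rt tau k + (length s - rt tau k) mod tl tau k.
Proof.
  intros H. unfold pr. rewrite length_app, length_firstn, length_skipn.
  destruct (tm_split k) as [H1 H2].
  pose proof (Nat.Div0.mod_le (length s - rt tau k) (tl tau k)). lia.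
Qed.

Lemma pr_incl k s : incl (pr tau k s) s.
Proof.
  intros x. unfold pr. rewrite in_app_iff, <- (firstn_skipn ((length s - rt tau k) mod tl tau k) s) at 1.
  intros [H|H].
  - rewrite <- (firstn_skipn ((length s - rt tau k) mod tl tau k) s).
    rewrite firstn_skipn in H. apply in_or_app. now left.
  - rewrite <- (firstn_skipn (length s - rt tau k) s). apply in_or_app. now right.
Qed.

(** A new top point raises the offset in the current block by one; by hypothesis this does not
    complete the block, so nothing is cut off. *)
Lemma pr_cons k x s : length (pr tau k s) + 1 < tm tau k ->
  pr tau k (x :: s) = x :: pr tau k s.
Proof.
  destruct (tm_split k) as [H1 H2]. intros H.
  destruct (le_lt_dec (rt tau k) (length s)) as [h|h].
  - rewrite pr_length in H by exact h. unfold pr; cbn [length].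
    set (q := (length s - rt tau k) mod tl tau k) in *.
    assert (Hq : (S (length s) - rt tau k) mod tl tau k = S q).
    { replace (S (length s) - rt tau k) with ((length s - rt tau k) + 1) by lia.
      rewrite <- Nat.Div0.add_mod_idemp_l. fold q. rewrite Nat.mod_small; lia. }
    rewrite Hq. replace (S (length s) - rt tau k) with (S (length s - rt tau k)) by lia.
    reflexivity.
  - rewrite !pr_small; cbn [length]; trivial; lia.
Qed.

(** Above the root there are only completed blocks, so the block under construction is empty and the
    root alone survives. *)
Lemma pr_bottom k i u v : length v = rt tau k -> length u = i * tl tau k ->
  pr tau k (u ++ v) = v.
Proof.
  intros Hv Hu. unfold pr. rewrite length_app, Hv.
  replace (length u + rt tau k - rt tau k) with (length u) by lia.
  rewrite Hu at 1. rewrite Nat.Div0.mod_mul. cbn. rewrite skipn_app, skipn_all, Nat.sub_diag.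
  reflexivity.
Qed.

(** The point [x] is the last of its block: the next point opens a new block and sees only the
    root. *)
Lemma pr_cons_max k x s : length (pr tau k s) + 1 = tm tau k ->
  exists u v, x :: s = u ++ v /\ length v = rt tau k /\ pr tau k (x :: s) = v.
Proof.
  destruct (tm_split k) as [H1 H2]. intros H.
  destruct (le_lt_dec (rt tau k) (length s)) as [h|h].
  - rewrite pr_length in H by exact h.
    exists (firstn (S (length s) - rt tau k) (x :: s)), (skipn (S (length s) - rt tau k) (x :: s)).
    rewrite firstn_skipn. split; [reflexivity|].
    split; [rewrite length_skipn; cbn [length]; lia|].
    unfold pr; cbn [length].
    replace ((S (length s) - rt tau k) mod tl tau k) with 0; [reflexivity|].
    replace (S (length s) - rt tau k) with ((length s - rt tau k) + 1) by lia.
    rewrite <- Nat.Div0.add_mod_idemp_l.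
    replace ((length s - rt tau k) mod tl tau k + 1) with (tl tau k) by lia.
    now rewrite Nat.Div0.mod_same.
  - rewrite pr_small in H by lia. lia.
Qed.

Lemma in_firstn_lt q u v y : NoDup (u ++ y :: v) -> In y (firstn q (u ++ y :: v)) -> length u < q.
Proof.
  intros Hn Hin. destruct (le_lt_dec q (length u)) as [h|h]; [|exact h]. exfalso.
  rewrite firstn_app in Hin. replace (q - length u) with 0 in Hin by lia.
  rewrite app_nil_r in Hin. apply NoDup_remove_2 in Hn. apply Hn, in_or_app. left.
  rewrite <- (firstn_skipn q u). apply in_or_app. now left.
Qed.

Lemma in_skipn_ge q u v y : NoDup (u ++ y :: v) -> In y (skipn q (u ++ y :: v)) -> q <= length u.
Proof.
  intros Hn Hin. destruct (le_lt_dec q (length u)) as [h|h]; [exact h|]. exfalso.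
  rewrite skipn_app in Hin. rewrite skipn_all2 in Hin by lia.
  replace (q - length u) with (S (q - length u - 1)) in Hin by lia. cbn in Hin.
  apply NoDup_remove_2 in Hn. apply Hn, in_or_app. right.
  rewrite <- (firstn_skipn (q - length u - 1) v). apply in_or_app. now right.
Qed.

(** The length of [v] is the position of [y], so the quotient is its block number. A surviving point
    outside the root lies in the block under construction. *)
Lemma in_pr_block k u v y : NoDup (u ++ y :: v) -> In y (pr tau k (u ++ y :: v)) ->
  rt tau k <= length v ->
  (length v - rt tau k) / tl tau k = (length (u ++ y :: v) - rt tau k) / tl tau k.
Proof.
  intros Hn Hin Hv. destruct (tm_split k) as [H1 H2].
  assert (L : length (u ++ y :: v) = length u + S (length v)) by (rewrite length_app; reflexivity).
  unfold pr in Hin. apply in_app_or in Hin as [Hin|Hin].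
  - apply in_firstn_lt in Hin; [|exact Hn]. rewrite L in *.
    set (p := length u + S (length v)) in *.
    pose proof (Nat.div_mod_eq (p - rt tau k) (tl tau k)) as E.
    pose proof (Nat.mod_upper_bound (p - rt tau k) (tl tau k)) as E2.
    symmetry. apply Nat.div_unique with
      (r := (length v - rt tau k) - tl tau k * ((p - rt tau k) / tl tau k)); lia.
  - apply in_skipn_ge in Hin; [|exact Hn]. rewrite L in Hin. lia.
Qed.

Lemma dn_refl k s : dn tau k k s = s.
Proof.
  destruct k as [|k]; [reflexivity|]. cbn [dn].
  destruct (Nat.leb_spec (S k) k); [lia|reflexivity].
Qed.

Lemma dn_S k' k s : k <= k' -> dn tau (S k') k s = dn tau k' k (pr tau k' s).
Proof. intros H. cbn [dn]. destruct (Nat.leb_spec k k'); [reflexivity|lia]. Qed.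

Lemma dn_trans k k' k'' s : k <= k' -> k' <= k'' ->
  dn tau k' k (dn tau k'' k' s) = dn tau k'' k s.
Proof.
  intros H H'. revert s. induction H' as [|k'' H' IH]; intros s.
  - now rewrite dn_refl.
  - rewrite !dn_S by lia. apply IH.
Qed.

Lemma pr_dn k k' s : k < k' -> pr tau k (dn tau k' (S k) s) = dn tau k' k s.
Proof.
  intros H. transitivity (dn tau (S k) k (dn tau k' (S k) s)).
  - now rewrite (@dn_S k k), dn_refl.
  - apply dn_trans; lia.
Qed.

End Proj.
End Types.

(** * Countability and the first uncountable ordinal *)

Fixpoint enc (l : list nat) : nat :=
  match l with
  | [] => 0
  | x :: l' => S (Cantor.to_nat (x, enc l'))
  end.

Lemma enc_inj l l' : enc l = enc l' -> l = l'.
Proof.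
  revert l'. induction l as [|x l IH]; intros [|x' l'] H; try discriminate; [reflexivity|].
  apply Nat.succ_inj, (Cantor.to_nat_inj (x, enc l) (x', enc l')) in H. injection H as -> H.
  now rewrite (IH _ H).
Qed.

Lemma map_inj_on (A B : Type) (f : A -> B) l l' :
  (forall x y, In x l -> In y l' -> f x = f y -> x = y) -> map f l = map f l' -> l = l'.
Proof.
  revert l'. induction l as [|x l IH]; intros [|x' l'] Hf H; try discriminate; [reflexivity|].
  injection H as H1 H2. f_equal.
  - apply Hf; auto; now left.
  - apply IH; auto. intros y y' Hy Hy'. apply Hf; now right.
Qed.

Lemma countable_union (A : Type) (P : nat -> A -> Prop) :
  (forall i, countable_set (P i)) -> countable_set (fun x => exists i, P i x).
Proof.
  intros H. pose (f i := proj1_sig (constructive_indefinite_description _ (H i))).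
  assert (Hf : forall i x y, P i x -> P i y -> f i x = f i y -> x = y)
    by (intros i; exact (proj2_sig (constructive_indefinite_description _ (H i)))).
  pose (ix x := epsilon (inhabits 0) (fun i => P i x)).
  assert (Hix : forall x, (exists i, P i x) -> P (ix x) x)
    by (intros x Hx; exact (epsilon_spec (inhabits 0) _ Hx)).
  exists (fun x => Cantor.to_nat (ix x, f (ix x) x)).
  intros x y Hx Hy E. apply Cantor.to_nat_inj in E. injection E as E1 E2.
  apply Hix in Hx. apply Hix in Hy. rewrite <- E1 in E2, Hy. exact (Hf _ _ _ Hx Hy E2).
Qed.

Lemma countable_sub (A : Type) (P Q : A -> Prop) :
  (forall x, P x -> Q x) -> countable_set Q -> countable_set P.
Proof. intros H [f Hf]. exists f. auto. Qed.

Lemma countable_image (A B : Type) (P : A -> Prop) (Q : B -> Prop) (g : A -> B) :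
  countable_set P -> (forall b, Q b -> exists a, P a /\ b = g a) -> countable_set Q.
Proof.
  intros [f Hf] H.
  pose (R b n := exists a, P a /\ b = g a /\ n = f a).
  assert (HR : forall b, Q b -> R b (epsilon (inhabits 0) (R b))).
  { intros b Hb. apply epsilon_spec. destruct (H b Hb) as (a & Ha & ->). exists (f a), a. auto. }
  exists (fun b => epsilon (inhabits 0) (R b)).
  intros x y Hx Hy E. apply HR in Hx as (a & Ha & -> & E1). apply HR in Hy as (a' & Ha' & -> & E2).
  f_equal. apply Hf; auto. congruence.
Qed.

Section Omega.
Variables (T : Type) (lt : T -> T -> Prop).
Hypothesis Hom : omega1 lt.

Lemma lt_asym x y : lt x y -> ~ lt y x.
Proof. intros H H'. exact (o_irrefl Hom _ (o_trans Hom _ _ _ H H')). Qed.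

Lemma nlt x y : ~ lt x y -> y = x \/ lt y x.
Proof. intros H. destruct (o_total Hom x y) as [h|[h|h]]; auto; contradiction. Qed.

Lemma lt_min (P : T -> Prop) : (exists x, P x) -> exists x, P x /\ forall y, lt y x -> ~ P y.
Proof.
  intros [x Hx]. apply NNPP. intros H.
  enough (forall z, ~ P z) by (now apply (H0 x)).
  intros z. induction z as [z IH] using (well_founded_induction (o_wf Hom)).
  intros Hz. apply H. now exists z.
Qed.

Lemma countable_below x : countable_set (fun y => lt y x).
Proof. destruct (o_segments Hom x) as [f Hf]. now exists f. Qed.

Lemma countable_eq x : countable_set (fun y : T => y = x).
Proof. exists (fun _ => 0). congruence. Qed.

Lemma countable_or (P Q : T -> Prop) :
  countable_set P -> countable_set Q -> countable_set (fun x => P x \/ Q x).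
Proof.
  intros HP HQ.
  apply countable_sub with (Q := fun x => exists i : nat, match i with 0 => P x | _ => Q x end).
  - intros x [h|h]; [exists 0|exists 1]; exact h.
  - apply (countable_union (fun i x => match i with 0 => P x | _ => Q x end)). now intros [|i].
Qed.

(** If [P] were unbounded, every ordinal would be at most some member of [P], and [T] would be a
    countable union of countable initial segments. *)
Lemma countable_bounded (P : T -> Prop) : countable_set P -> exists b, forall z, P z -> lt z b.
Proof.
  intros [f Hf]. apply NNPP. intros H. apply (o_uncountable Hom).
  assert (HT : countable_set (fun _ : T => True)); [|destruct HT as [g Hg]; exists g; auto].
  apply countable_sub with
    (Q := fun y => exists i, exists z, P z /\ f z = i /\ (lt y z \/ y = z)).
  - intros y _. apply NNPP. intros Hy. apply H. exists y. intros z Hz. apply NNPP. intros h.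
    apply Hy. exists (f z), z. repeat split; auto. apply nlt in h. tauto.
  - apply (countable_union (fun i y => exists z, P z /\ f z = i /\ (lt y z \/ y = z))).
    intros i. destruct (classic (exists z, P z /\ f z = i)) as [(z & Hz & Ez)|N].
    + apply countable_sub with (Q := fun y => lt y z \/ y = z).
      * intros y (z' & Hz' & Ez' & h). replace z with z'; auto. apply Hf; congruence.
      * apply countable_or; [apply countable_below|apply countable_eq].
    + exists (fun _ => 0). intros y y' (z & Hz & Ez & _). exfalso. apply N. now exists z.
Qed.

Lemma list_bounded l : exists b, forall x, In x l -> lt x b.
Proof.
  apply countable_bounded. induction l as [|x l IH].
  - exists (fun _ => 0). contradiction.
  - apply countable_sub with (Q := fun y => y = x \/ In y l); [cbn; intuition|].
    apply countable_or; [apply countable_eq|exact IH].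
Qed.

Lemma sc_ex x : exists y, lt x y /\ forall z, lt z y -> z = x \/ lt z x.
Proof.
  destruct (@list_bounded [x]) as [b Hb]. destruct (@lt_min (lt x)) as (y & Hy & Hm).
  - exists b. apply Hb. now left.
  - exists y. split; [exact Hy|]. intros z Hz. apply nlt. now apply Hm.
Qed.

Definition sc (x : T) : T := epsilon (inhabits x) (fun y => lt x y /\ forall z, lt z y -> z = x \/ lt z x).

Lemma sc_spec x : lt x (sc x) /\ forall z, lt z (sc x) -> z = x \/ lt z x.
Proof. apply (epsilon_spec (inhabits x) (fun y => lt x y /\ forall z, lt z y -> z = x \/ lt z x)). apply sc_ex. Qed.

Lemma lt_sc x : lt x (sc x).
Proof. apply sc_spec. Qed.

Lemma sc_inj x y : sc x = sc y -> x = y.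
Proof.
  intros E. pose proof (lt_sc x) as H. rewrite E in H. apply sc_spec in H as [h|h]; auto.
  pose proof (lt_sc y) as H'. rewrite <- E in H'. apply sc_spec in H' as [h'|h']; auto.
  exfalso. exact (lt_asym h h').
Qed.

Definition scn (q : nat) (x : T) : T := Nat.iter q sc x.

Lemma le_scn q x : scn q x = x \/ lt x (scn q x).
Proof.
  induction q as [|q [IH|IH]]; [now left| |]; right; change (scn (S q) x) with (sc (scn q x)).
  - rewrite IH. apply lt_sc.
  - exact (o_trans Hom _ _ _ IH (lt_sc _)).
Qed.

Lemma sc_lt_limit d x : is_limit lt d -> lt x d -> lt (sc x) d.
Proof.
  intros [_ Hd] Hx. destruct (Hd x Hx) as (z & Hz & Hzd).
  destruct (o_total Hom (sc x) d) as [h|[h|h]]; auto; exfalso.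
  - rewrite <- h in Hzd. apply sc_spec in Hzd as [->|h']; [exact (o_irrefl Hom _ Hz)|exact (lt_asym Hz h')].
  - pose proof (o_trans Hom _ _ _ Hzd h) as h'.
    apply sc_spec in h' as [->|h']; [exact (o_irrefl Hom _ Hz)|exact (lt_asym Hz h')].
Qed.

Lemma scn_lt_limit d q x : is_limit lt d -> lt x d -> lt (scn q x) d.
Proof. intros Hd Hx. induction q; cbn; auto. now apply sc_lt_limit. Qed.

Lemma sc_not_limit x : ~ is_limit lt (sc x).
Proof. intros H. apply (o_irrefl Hom (sc x)). apply sc_lt_limit; auto. apply lt_sc. Qed.

(** A successor is never a limit, so stripping successors from both sides stops at the same
    moment. *)
Lemma scn_limit_inj a b i j : is_limit lt a -> is_limit lt b -> scn i a = scn j b -> a = b /\ i = j.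
Proof.
  intros Ha Hb. revert j. induction i as [|i IH]; intros [|j] E; cbn in E; auto.
  - exfalso. subst a. exact (sc_not_limit _ Ha).
  - exfalso. subst b. exact (sc_not_limit _ Hb).
  - apply sc_inj in E. destruct (IH _ E). auto.
Qed.

(** The limit is the least strict upper bound, which exists because countable sets are bounded. *)
Lemma limit_of_sequence (f : nat -> T) : (forall i, lt (f i) (f (S i))) ->
  exists d, is_limit lt d /\ (forall i, lt (f i) d) /\ forall y, lt y d -> exists i, lt y (f i).
Proof.
  intros Hf. destruct (@lt_min (fun d => forall i, lt (f i) d)) as (d & Hd & Hm).
  - destruct (@countable_bounded (fun z => exists i, z = f i)) as [b Hb].
    + apply (countable_union (fun i z => z = f i)). intros i. apply countable_eq.
    + exists b. eauto.
  - assert (H : forall y, lt y d -> exists i, lt y (f i)).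
    { intros y Hy. apply NNPP. intros N. apply (Hm y Hy). intros i.
      destruct (@nlt y (f (S i))) as [h|h]; [intros h; apply N; eauto|rewrite <- h; auto|].
      exact (o_trans Hom _ _ _ (Hf i) h). }
    exists d. repeat split; auto.
    + exists (f 0). auto.
    + intros y Hy. destruct (H y Hy) as [i Hi]. eauto.
Qed.

Lemma limit_above x : exists d, is_limit lt d /\ lt x d.
Proof.
  destruct (@limit_of_sequence (fun i => scn i x)) as (d & Hd & H & _).
  - intros i. apply lt_sc.
  - exists d. split; auto. apply (H 0).
Qed.

Lemma limit_list_bounded d l : is_limit lt d -> (forall x, In x l -> lt x d) ->
  exists y, lt y d /\ forall x, In x l -> lt x y.
Proof.
  intros Hd. induction l as [|x l IH]; intros Hl.
  - destruct Hd as [[y Hy] _]. exists y. split; auto. contradiction.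
  - destruct IH as (y & Hy & H). { intros; apply Hl; now right. }
    assert (Hx : lt x d) by (apply Hl; now left).
    destruct (o_total Hom (sc x) y) as [h|h].
    + exists y. split; auto. intros z [<-|hz]; auto. exact (o_trans Hom _ _ _ (lt_sc _) h).
    + exists (sc x). split; [now apply sc_lt_limit|]. intros z [<-|hz]; [apply lt_sc|].
      destruct h as [->|h]; auto. exact (o_trans Hom _ _ _ (H z hz) h).
Qed.

(** For unboundedness, a function [g] whose value at [x] bounds the images under [b] of all points
    below [x] is iterated omega times; the supremum is closed under [b]. *)
Lemma club_closed_under x0 (b : T -> T) : club lt (fun d => lt x0 d /\ forall z, lt z d -> lt (b z) d).
Proof.
  split.
  - assert (Hs : forall x, exists y, lt x y /\ forall z, lt z x -> lt (b z) y).
    { intros x. destruct (@countable_bounded (fun y => y = x \/ exists z, lt z x /\ y = b z)) as [y Hy].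
      - apply countable_or; [apply countable_eq|].
        apply countable_image with (P := fun z => lt z x) (g := b); [apply countable_below|auto].
      - exists y. split; [apply Hy; auto|]. intros z Hz. apply Hy. eauto. }
    intros x. pose (g x := proj1_sig (constructive_indefinite_description _ (Hs x))).
    assert (Hg : forall x, lt x (g x) /\ forall z, lt z x -> lt (b z) (g x))
      by (intros y; exact (proj2_sig (constructive_indefinite_description _ (Hs y)))).
    destruct (@list_bounded [x; x0]) as [y Hy].
    destruct (@limit_of_sequence (fun i => Nat.iter i g y)) as (d & Hd & H1 & H2).
    { intros i. apply Hg. }
    exists d. repeat split.
    + exact (o_trans Hom _ _ _ (Hy x0 (or_intror (or_introl eq_refl))) (H1 0)).
    + intros z Hz. destruct (H2 z Hz) as [i Hi].
      refine (o_trans Hom _ _ _ _ (H1 (S i))). now apply Hg.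
    + exact (o_trans Hom _ _ _ (Hy x (or_introl eq_refl)) (H1 0)).
  - intros d [[y Hy] _] H. split.
    + destruct (H y Hy) as (c & [Hc _] & _ & Hcd). exact (o_trans Hom _ _ _ Hc Hcd).
    + intros z Hz. destruct (H z Hz) as (c & [_ Hc] & Hzc & Hcd).
      exact (o_trans Hom _ _ _ (Hc z Hzc) Hcd).
Qed.

(** * Ordinals as codes for pairs of a finite set and an ordinal *)

Definition seg (x : T) : T -> nat :=
  proj1_sig (constructive_indefinite_description _ (o_segments Hom x)).

Lemma seg_inj x y z : lt y x -> lt z x -> seg x y = seg x z -> y = z.
Proof. exact (proj2_sig (constructive_indefinite_description _ (o_segments Hom x)) y z). Qed.

(* The ordinal [d + j], with [d] limit, codes the [j]-th pair made of a finite set and an ordinal below [d]. *)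
Definition codes (z : T) (p : list T * T) : Prop :=
  exists d j, is_limit lt d /\ z = scn j d /\ (forall x, In x (snd p :: fst p) -> lt x d) /\
    enc (map (seg d) (snd p :: fst p)) = j.

Definition dec (z : T) : list T * T := epsilon (inhabits ([], z)) (codes z).

(** The limit part of the code can be taken above any given ordinals, so every pair has arbitrarily
    large codes. Decoding is unambiguous because limit part, natural number and numbering [seg] are
    determined by the code. *)
Lemma dec_surj D g x : exists z, dec z = (D, g) /\ lt x z /\ lt g z /\ forall y, In y D -> lt y z.
Proof.
  destruct (@list_bounded (x :: g :: D)) as [b Hb].
  destruct (limit_above b) as (d & Hd & Hbd).
  assert (Hl : forall y, In y (x :: g :: D) -> lt y d)
    by (intros y Hy; exact (o_trans Hom _ _ _ (Hb y Hy) Hbd)).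
  pose (j := enc (map (seg d) (g :: D))).
  assert (Hz : codes (scn j d) (D, g)).
  { exists d, j. split; [exact Hd|]. split; [reflexivity|]. split; [|reflexivity].
    intros y Hy. apply Hl. now right. }
  assert (Hlt : forall y, lt y d -> lt y (scn j d)).
  { intros y Hy. destruct (le_scn j d) as [->|h]; auto. exact (o_trans Hom _ _ _ Hy h). }
  exists (scn j d). repeat split; try (intros; apply Hlt, Hl; cbn; auto).
  pose proof (epsilon_spec (inhabits ([], scn j d)) (codes (scn j d)) (ex_intro _ _ Hz)) as H.
  fold (dec (scn j d)) in H.
  destruct H as (d' & j' & Hd' & E & Hl' & E').
  apply scn_limit_inj in E as [<- E]; auto. rewrite <- E in E'.
  change j with (enc (map (seg d) (g :: D))) in E' at 3.
  apply enc_inj, map_inj_on in E'.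
  - destruct (dec (scn j d)). cbn in E'. congruence.
  - intros y y' Hy Hy'. apply seg_inj; auto. apply Hl. now right.
Qed.

Lemma not_countable_unbounded (P : T -> Prop) :
  (forall x, exists z, P z /\ lt x z) -> ~ countable_set P.
Proof.
  intros H Hc. destruct (countable_bounded Hc) as [b Hb]. destruct (H b) as (z & Hz & h).
  exact (lt_asym h (Hb z Hz)).
Qed.

End Omega.

Unset Strict Implicit.

(** * Rows and states *)

(* [A x k] lists the strict predecessors of [x] at level [k], top first: it is the paper's
   [{y < x : rho(y, x) <= k}]. [covers] is a modulus of goodness of the type. *)
Definition covers (tau : type_seq) (cov : nat -> nat) : Prop :=
  forall k, k < cov k /\ forall a, a <= tm tau k -> exists j, k <= j < cov k /\ rt tau j = a.

(** The clause [row_gap] keeps the recursion going: infinitely often the row is constant from level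
    [k] up to [cov (cov k)] and leaves room for [c] more points, while all root sizes up to
    [tm tau k] occur in between. *)
Record row (T : Type) (lt : T -> T -> Prop) (tau : type_seq) (cov : nat -> nat)
  (A : T -> nat -> list T) (d : T) (P : nat -> list T) : Prop := {
  row_state : forall k, P k = [] \/ exists b, lt b d /\ P k = b :: A b k;
  row_len : forall k, length (P k) < tm tau k;
  row_pr : forall k, pr tau k (P (S k)) = P k;
  row_cover : forall y, lt y d -> exists k, In y (P k);
  row_gap : forall c, exists k, c <= k /\ length (P (cov (cov k))) + c < tm tau k }.

(** A state is a value that the row of a new point above [X] could take at level [k]. *)
Definition st (T : Type) (tau : type_seq) (A : T -> nat -> list T) (X : T -> Prop)
  (k : nat) (s : list T) : Prop :=
  (s = [] \/ exists b, X b /\ s = b :: A b k) /\ length s < tm tau k.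

Section Rows.
Variables (T : Type) (lt : T -> T -> Prop).
Hypothesis Hom : omega1 lt.
Variable tau : type_seq.
Hypothesis Htau : is_type tau.
Variable cov : nat -> nat.
Hypothesis Hcov : covers tau cov.
Variables (A : T -> nat -> list T) (X : T -> Prop).
Hypothesis HX : forall x y, lt y x -> X x -> X y.
Hypothesis HR : forall x, X x -> row lt tau cov A x (A x).

Lemma cov_gt k : k < cov k.
Proof. apply Hcov. Qed.

(** A nonempty row is a point followed by the row of that point, so what follows any point in it is
    the row of that point. This coherence makes intersections of members initial segments. *)
Lemma suffix_A k u : forall b y v, X b -> b :: A b k = u ++ y :: v ->
  v = A y k /\ X y /\ (y = b \/ lt y b).
Proof.
  induction u as [|c u IH]; intros b y v Hb E.
  - injection E as -> <-. auto.
  - injection E as -> E. destruct (row_state (HR Hb) k) as [E0|(b' & Hlt & E0)].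
    + rewrite E0 in E. destruct u; discriminate.
    + rewrite E0 in E. destruct (IH _ _ _ (HX Hlt Hb) E) as (H1 & H2 & H3).
      repeat split; auto. right. destruct H3 as [->|H3]; auto. exact (o_trans Hom _ _ _ H3 Hlt).
Qed.

Lemma A_suffix k x u y v : X x -> A x k = u ++ y :: v -> v = A y k /\ X y /\ lt y x.
Proof.
  intros Hx E. destruct (row_state (HR Hx) k) as [E0|(b & Hlt & E0)].
  - rewrite E0 in E. destruct u; discriminate.
  - rewrite E0 in E. destruct (suffix_A (HX Hlt Hx) E) as (H1 & H2 & H3).
    repeat split; auto. destruct H3 as [->|H3]; auto. exact (o_trans Hom _ _ _ H3 Hlt).
Qed.

Lemma in_A k x y : X x -> In y (A x k) -> (exists u, A x k = u ++ y :: A y k) /\ X y /\ lt y x.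
Proof.
  intros Hx H. apply in_split in H as (u & v & E).
  destruct (A_suffix Hx E) as (E' & H1 & H2). rewrite E' in E. eauto.
Qed.

Lemma A_lt k x y : X x -> In y (A x k) -> lt y x.
Proof. intros Hx H. now apply (in_A Hx H). Qed.

Lemma A_trans k x y z : X x -> In y (A x k) -> In z (A y k) -> In z (A x k).
Proof.
  intros Hx Hy Hz. apply in_A in Hy as [[u ->] _]; auto. apply in_or_app. right. now right.
Qed.

Lemma A_length_lt k x y : X x -> In y (A x k) -> length (A y k) < length (A x k).
Proof.
  intros Hx Hy. apply in_A in Hy as [[u ->] _]; auto. rewrite length_app. cbn. lia.
Qed.

Lemma A_linear k x y z : X x -> In y (A x k) -> In z (A x k) -> lt z y -> In z (A y k).
Proof.
  intros Hx Hy Hz Hlt. destruct (in_A Hx Hy) as ([u E] & Xy & _). rewrite E in Hz.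
  apply in_app_or in Hz as [Hz|[->|Hz]]; auto; exfalso.
  - apply in_split in Hz as (u1 & u2 & ->). rewrite <- app_assoc in E.
    change ((z :: u2) ++ y :: A y k) with (z :: (u2 ++ y :: A y k)) in E.
    destruct (A_suffix Hx E) as (E' & Xz & _).
    assert (h : In y (A z k)) by (rewrite <- E'; apply in_or_app; right; now left).
    apply A_lt in h; auto. exact (lt_asym Hom _ _ h Hlt).
  - exact (o_irrefl Hom _ Hlt).
Qed.

Lemma A_in_of_length k x y z : X x -> In y (A x k) -> In z (A x k) ->
  length (A z k) < length (A y k) -> In z (A y k).
Proof.
  intros Hx Hy Hz H. destruct (o_total Hom z y) as [h|[->|h]]; [|lia|].
  - now apply A_linear with x.
  - exfalso. assert (h' : In y (A z k)) by now apply A_linear with x.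
    apply A_length_lt in h'; [lia|]. now apply (in_A Hx Hz).
Qed.

Lemma A_NoDup k x : X x -> NoDup (A x k).
Proof.
  induction x as [x IH] using (well_founded_induction (o_wf Hom)). intros Hx.
  destruct (row_state (HR Hx) k) as [->|(b & Hlt & ->)]; [constructor|].
  assert (Xb := HX Hlt Hx). constructor; auto.
  intros h. apply A_lt in h; auto. exact (o_irrefl Hom _ h).
Qed.

Lemma A_sorted k x : X x -> StronglySorted (fun a b => lt b a) (x :: A x k).
Proof.
  induction x as [x IH] using (well_founded_induction (o_wf Hom)). intros Hx.
  constructor.
  - destruct (row_state (HR Hx) k) as [->|(b & Hlt & ->)]; [constructor|].
    apply IH; auto. exact (HX Hlt Hx).
  - apply Forall_forall. intros y Hy. now apply A_lt in Hy.
Qed.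

Lemma A_mono k k' x y : X x -> k <= k' -> In y (A x k) -> In y (A x k').
Proof.
  intros Hx H Hy. induction H as [|k' H IH]; auto.
  rewrite <- (row_pr (HR Hx)) in IH. now apply pr_incl in IH.
Qed.

Lemma A_dn k k' x : X x -> k <= k' -> dn tau k' k (A x k') = A x k.
Proof.
  intros Hx H. induction H as [|k' H IH]; [apply dn_refl|].
  rewrite dn_S by exact H. now rewrite (row_pr (HR Hx)).
Qed.

Lemma dn_small k k' (s : list T) : length s < tm tau k -> dn tau k' k s = s.
Proof.
  intros Hs. destruct (le_lt_dec k k') as [H|H].
  - induction H as [|k' H IH]; [apply dn_refl|]. rewrite dn_S by exact H.
    rewrite pr_small; auto. pose proof (tm_le Htau H). lia.
  - destruct k'; [reflexivity|]. cbn [dn]. destruct (Nat.leb_spec k k'); [lia|reflexivity].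
Qed.

Lemma A_const k k' x : X x -> k <= k' -> length (A x k') < tm tau k -> A x k = A x k'.
Proof. intros Hx H Hs. rewrite <- (A_dn Hx H) at 1. now apply dn_small. Qed.

Lemma A_all k0 x l : X x -> (forall y, In y l -> lt y x) ->
  exists k, k0 <= k /\ forall k', k <= k' -> incl l (A x k').
Proof.
  intros Hx. induction l as [|y l IH]; intros Hl.
  - exists k0. split; [lia|]. intros k' _ z [].
  - destruct IH as (k & Hk & H). { intros; apply Hl; now right. }
    destruct (row_cover (HR Hx) (Hl y (or_introl eq_refl))) as [j Hj].
    exists (max k j). split; [lia|]. intros k' Hk' z [<-|Hz].
    + apply A_mono with j; auto. lia.
    + apply H; auto. lia.
Qed.

(** The room left in the current block is at most the room left in the whole member, so slack
    survives the passage to a higher level. *)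
Lemma pr_gap k c (s : list T) : length s < tm tau (S k) -> length (pr tau k s) + c < tm tau k ->
  length s + c < tm tau (S k).
Proof.
  intros H1 H2. destruct (tm_split Htau k) as [E1 E2]. pose proof (tm_S Htau k) as E3.
  pose proof (nb_ge2 Htau k).
  destruct (le_lt_dec (rt tau k) (length s)) as [h|h].
  - rewrite pr_length in H2 by assumption.
    pose proof (Nat.div_mod_eq (length s - rt tau k) (tl tau k)) as E.
    set (q := (length s - rt tau k) mod tl tau k) in *.
    set (i := (length s - rt tau k) / tl tau k) in *.
    assert (i < nb tau k) by nia.
    assert (tl tau k * (i + 1) <= tl tau k * nb tau k) by (apply Nat.mul_le_mono_l; lia). lia.
  - rewrite pr_small in H2 by (trivial; lia).
    assert (tl tau k * 1 <= tl tau k * nb tau k) by (apply Nat.mul_le_mono_l; lia). lia.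
Qed.

Lemma A_gap k k' c x : X x -> k <= k' -> length (A x k) + c < tm tau k ->
  length (A x k') + c < tm tau k'.
Proof.
  intros Hx H Hc. induction H as [|k' H IH]; auto.
  apply pr_gap; [apply (HR Hx)|]. now rewrite (row_pr (HR Hx)).
Qed.

(** A path can wait at [x]: as long as [x] is not the last point of its block, it stays on top of
    the state while the level grows. *)
Lemma stay_pr k x : X x -> length (A x k) + 1 < tm tau k ->
  pr tau k (x :: A x (S k)) = x :: A x k.
Proof. intros Hx H. rewrite pr_cons; rewrite ?(row_pr (HR Hx)); auto. Qed.

Lemma stay_dn k k' x : X x -> k <= k' -> length (A x k) + 1 < tm tau k ->
  dn tau k' k (x :: A x k') = x :: A x k.
Proof.
  intros Hx H Hc. induction H as [|k' H IH]; [apply dn_refl|].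
  rewrite dn_S by exact H. rewrite stay_pr; auto. now apply A_gap with k.
Qed.

Lemma st_stay k x : X x -> length (A x k) + 1 < tm tau k -> st tau A X k (x :: A x k).
Proof. intros Hx H. split; [right; eauto|]. cbn. lia. Qed.

Lemma st_nil k : st tau A X k [].
Proof. split; [now left|]. pose proof (tm_gt Htau k). cbn. lia. Qed.

Lemma st_pr k s : st tau A X (S k) s -> st tau A X k (pr tau k s).
Proof.
  intros [[->|(b & Hb & ->)] Hs].
  - rewrite pr_small; [apply st_nil|assumption|pose proof (tm_gt Htau k); cbn; lia].
  - pose proof (row_len (HR Hb) k) as Hl.
    destruct (Nat.eq_dec (length (A b k) + 1) (tm tau k)) as [E|N].
    (* Here [b] completes a block and only the root [v] survives. Since [v] is shorter than
       [tm tau k], the row of its top is the same at levels [k] and [S k], so [v] is again a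
       state. *)
    + rewrite <- (row_pr (HR Hb)) in E.
      destruct (pr_cons_max Htau k b _ E) as (u & v & E1 & E2 & ->).
      pose proof (rt_lt Htau k) as Hr. split; [|lia].
      destruct v as [|z v]; [now left|]. right.
      destruct (suffix_A Hb E1) as (-> & Xz & _). cbn in E2. exists z. split; auto.
      f_equal. symmetry. apply A_const; auto. lia.
    + rewrite stay_pr by (trivial; lia). apply st_stay; auto. lia.
Qed.

Lemma st_dn k k' s : k <= k' -> st tau A X k' s -> st tau A X k (dn tau k' k s).
Proof.
  intros H. revert s. induction H as [|k' H IH]; intros s Hs.
  - now rewrite dn_refl.
  - rewrite dn_S by exact H. apply IH. now apply st_pr.
Qed.

(** At a high level the row of the successor contains [x], which must then be its top; by the slack
    this survives the projection down to level [k]. *)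
Lemma sc_A k x : X (sc lt x) -> length (A x k) + 1 < tm tau k -> A (sc lt x) k = x :: A x k.
Proof.
  intros Hs Hc. assert (Hx : X x) by exact (HX (lt_sc Hom x) Hs).
  destruct (@A_all k (sc lt x) [x] Hs) as (k' & Hk & H).
  { intros y [<-|[]]. apply (lt_sc Hom). }
  assert (E : A (sc lt x) k' = x :: A x k').
  { specialize (H k' (le_n _) x (or_introl eq_refl)).
    destruct (row_state (HR Hs) k') as [E|(b & Hlt & E)]; rewrite E in H; [destruct H|].
    destruct H as [->|H]; [exact E|]. exfalso. apply A_lt in H; [|exact (HX Hlt Hs)].
    apply (proj2 (sc_spec Hom x)) in Hlt as [->|Hlt]; [exact (o_irrefl Hom _ H)|].
    exact (lt_asym Hom _ _ H Hlt). }
  rewrite <- (A_dn Hs Hk), E. now apply stay_dn.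
Qed.

Lemma scn_A k q x : X (scn lt q x) -> length (A x k) + q < tm tau k ->
  exists u, length u = q /\ scn lt q x :: A (scn lt q x) k = u ++ x :: A x k.
Proof.
  induction q as [|q IH]; intros Hq Hc.
  - exists []. auto.
  - change (scn lt (S q) x) with (sc lt (scn lt q x)) in *.
    destruct IH as (u & E1 & E2).
    + exact (HX (lt_sc Hom _) Hq).
    + lia.
    + exists (sc lt (scn lt q x) :: u). split; [cbn; lia|].
      rewrite sc_A; auto; [now rewrite E2|].
      apply (f_equal (@length T)) in E2. rewrite length_app in E2. cbn in E2. lia.
Qed.

Lemma in_A_block k x y : X x -> In y (A x k) -> rt tau k <= length (A y (S k)) ->
  (length (A y (S k)) - rt tau k) / tl tau k = (length (A x (S k)) - rt tau k) / tl tau k.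
Proof.
  intros Hx Hy Hr. assert (Hy' : In y (A x (S k))) by (apply A_mono with k; auto).
  destruct (in_A Hx Hy') as ([u E] & _).
  rewrite E. apply in_pr_block; auto.
  - rewrite <- E. now apply A_NoDup.
  - rewrite <- E. now rewrite (row_pr (HR Hx)).
Qed.

End Rows.

(** * Capturing at limits *)

(* The sets coded by the guess at [d], or by the guesses at the ordinals which it codes, hereditarily. *)
Inductive known (T : Type) (lt : T -> T -> Prop) (dc : T -> nat -> list T * T) : T -> list T -> Prop :=
| known_now d i : known lt dc d (fst (dc d i))
| known_before d i D : is_limit lt (snd (dc d i)) -> lt (snd (dc d i)) d -> known lt dc (snd (dc d i)) D -> known lt dc d D.

(* [s'] is a root of level [S L] reachable from the state [(k, s)]; blocks [0 .. b - 1] above it hold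
   the tails of known sets, and a point whose list of predecessors is [p] lies in block [b]. *)
Definition capt (T : Type) (lt : T -> T -> Prop) (tau : type_seq) (cov : nat -> nat)
  (A : T -> nat -> list T) (d : T) (kn : list T -> Prop) (b : nat) (R : list T)
  (k : nat) (s : list T) (L : nat) (p : list T) : Prop :=
  exists L0 s' v (Ds : nat -> list T),
    (k <= L0 /\ st tau A (fun x => lt x d) L0 s' /\ dn tau L0 k s' = s) /\
    (cov L0 <= L /\ length s' = rt tau L /\ incl R s') /\
    (p = v ++ s' /\ length v / tl tau L = b) /\
    forall i, i < b -> kn (Ds i) /\ exists D', Ds i = R ++ D' /\ D' <> [] /\
      forall x, In x D' -> lt x d /\ In x p /\ rt tau L <= length (A x (S L)) /\
        (length (A x (S L)) - rt tau L) / tl tau L = i.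

Definition cap (T : Type) (lt : T -> T -> Prop) (tau : type_seq) (cov : nat -> nat)
  (A : T -> nat -> list T) (d : T) (kn : list T -> Prop) (b : nat) (R : list T)
  (P : nat -> list T) : Prop :=
  forall k s, st tau A (fun x => lt x d) k s -> exists L, capt lt tau cov A d kn b R k s L (P (S L)).

Definition guess (T : Type) (lt : T -> T -> Prop) (tau : type_seq) (cov : nat -> nat)
  (dc : T -> nat -> list T * T) (A : T -> nat -> list T) (d : T) (b : nat) (R : list T) : Prop :=
  forall y, lt y d -> exists i, let g := snd (dc d i) in
    (lt y g /\ lt g d /\ is_limit lt g) /\ (forall x, In x R -> lt x g) /\
    cap lt tau cov A g (known lt dc g) b R (A g) /\
    exists D', fst (dc d i) = R ++ D' /\ D' <> [] /\ forall x, In x D' -> (x = g \/ lt g x) /\ lt x d.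

(** Capturing [S b] blocks puts [d] into block number [S b], which exists only if there are at least
    [b + 2] blocks. The clause for zero blocks starts the induction. *)
Definition spec (T : Type) (lt : T -> T -> Prop) (tau : type_seq) (cov : nat -> nat)
  (dc : T -> nat -> list T * T) (A : T -> nat -> list T) (d : T) (P : nat -> list T) : Prop :=
  row lt tau cov A d P /\
  (is_limit lt d -> forall R, (forall x, In x R -> lt x d) ->
    cap lt tau cov A d (known lt dc d) 0 R P /\
    forall b, (exists M, forall k, M <= k -> b + 2 <= nb tau k) ->
      guess lt tau cov dc A d b R -> cap lt tau cov A d (known lt dc d) (S b) R P).

(** * Extending states below a limit *)

Section Below.
Variables (T : Type) (lt : T -> T -> Prop).
Hypothesis Hom : omega1 lt.
Variable tau : type_seq.
Hypothesis Htau : is_type tau.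
Variable cov : nat -> nat.
Hypothesis Hcov : covers tau cov.
Variables (A : T -> nat -> list T) (d : T).
Hypothesis Hd : is_limit lt d.
Let X := fun x => lt x d.
Hypothesis HR : forall x, X x -> row lt tau cov A x (A x).

Lemma below_closed x y : lt y x -> X x -> X y.
Proof. exact (o_trans Hom y x d). Qed.
Let HX : forall x y, lt y x -> X x -> X y := @below_closed.

(* Between levels [L0] and [L] the row of [y] does not grow, which [row_gap] allows
   infinitely often. *)
Lemma quiet_stretch y N : X y -> exists L0 L, N <= L0 /\ cov L0 <= L /\ length (A y L0) + 2 < tm tau L0 /\
  rt tau L = length (A y L0) + 1 /\ A (sc lt y) L = y :: A y L0 /\ A (sc lt y) (S L) = y :: A y L0.
Proof.
  (* The summand 2 leaves room for [y] and one further point. *)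
  intros Hy. destruct (row_gap (HR Hy) (N + 2)) as (L0 & HN & Hg).
  pose proof (Hcov L0) as [h1 _]. pose proof (Hcov (cov L0)) as [h2 Hc].
  assert (E0 : forall j, L0 <= j -> j <= cov (cov L0) -> A y j = A y (cov (cov L0))).
  { intros j Hj Hj'. apply (A_const Htau HR); auto. pose proof (tm_le Htau Hj). lia. }
  (* The second stretch, from [cov L0] to [cov (cov L0)], contains a level whose root has the size
     of [y :: A y L0]; the first is kept for the waiting in [carrier]. *)
  destruct (Hc (length (A y L0) + 1)) as (L & HL & HrL).
  { rewrite E0 by lia. pose proof (@tm_le tau Htau L0 (cov L0)). lia. }
  exists L0, L. rewrite (E0 L0) in * by lia.
  assert (Xs : X (sc lt y)) by (apply (sc_lt_limit Hom); auto).
  assert (E : forall j, L0 <= j -> j <= cov (cov L0) ->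
    A (sc lt y) j = y :: A y (cov (cov L0))).
  { intros j Hj Hj'. rewrite (sc_A Hom Htau HX HR); auto; rewrite E0 by lia; auto.
    pose proof (tm_le Htau Hj). lia. }
  repeat split; try lia; apply E; lia.
Qed.

(* A path with state [(k1, s1)] waits until its length is the root size of some level [S l1] between [L0]
   and [cov L0], jumps to a full block [u] above [w], and then follows [u] up to level [S L]. *)
Lemma carrier k1 s1 L0 L w b s' : st tau A X k1 s1 -> k1 <= L0 -> cov L0 <= L ->
  (s1 = [] \/ exists z, s1 = z :: A z k1 /\ In z s') ->
  X w -> A w L = s' -> length s' < tm tau L0 -> length s' = rt tau L ->
  length (A w (S L)) = rt tau L + b * tl tau L -> b < nb tau L ->
  exists u v, X u /\ st tau A X (S L) (u :: A u (S L)) /\ dn tau (S L) k1 (u :: A u (S L)) = s1 /\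
    u :: A u (S L) = v ++ w :: A w (S L) /\ length v + 1 < tl tau L.
Proof.
  intros Hs1 Hk1 HL Htop Hw Ew Hs' Er Ew' Hb.
  destruct (Hcov L0) as [_ Hc].
  (* The waiting ends at [l1], where the root size equals the length of the state [s0] held by the
     path: the empty list, or the part of [s'] from [z] downwards. *)
  assert (Ha : exists l1 s0 v0, L0 <= l1 < cov L0 /\ s' = v0 ++ s0 /\ length s0 = rt tau l1 /\
    dn tau l1 k1 s0 = s1).
  { destruct Htop as [->|(z & -> & Hz)].
    - destruct (Hc 0) as (l1 & Hl & El); [lia|]. exists l1, [], s'. rewrite app_nil_r.
      repeat split; auto; try lia. apply (dn_small Htau). pose proof (tm_gt Htau k1). cbn. lia.
    - rewrite <- Ew in Hz. destruct (in_A Hom HX HR Hw Hz) as ([v0 E] & Xz & _).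
      rewrite Ew in E. assert (Hlen : length (A z L) + 1 <= length s')
        by (rewrite E, length_app; cbn; lia).
      destruct (Hc (length (A z L) + 1)) as (l1 & Hl & El); [lia|].
      exists l1, (z :: A z L), v0. repeat split; auto; try (cbn; lia).
      replace (A z L) with (A z l1).
      + apply (stay_dn Htau HR); auto; [lia|]. destruct Hs1 as [_ Hs1]. cbn in Hs1. lia.
      + apply (A_const Htau HR); auto; [lia|]. pose proof (@tm_le tau Htau L0 l1). lia. }
  destruct Ha as (l1 & s0 & v0 & Hl1 & Es' & Hs0 & Ed).
  pose proof (@tm_le tau Htau L0 l1) as M1. pose proof (@tm_lt tau Htau l1 L) as M2.
  pose proof (tm_lt_S Htau l1) as M3. pose proof (tm_split Htau L) as [M4 M5].
  pose proof (tm_split Htau l1) as [M6 M7]. pose proof (tm_S Htau L) as M8.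
  assert (M9 : (b + 1) * tl tau L <= tl tau L * nb tau L)
    by (rewrite Nat.mul_comm; apply Nat.mul_le_mono_l; lia).
  (* With [q] successors above [w], the list [u :: A u L] has exactly [tm tau l1] elements. *)
  pose (q := tm tau l1 - 1 - length s'). pose (u := scn lt q w).
  assert (Xu : X u) by (apply (scn_lt_limit Hom); auto).
  destruct (@scn_A T lt Hom tau Htau cov A X HX HR L q w Xu) as (v1 & Hv1 & E1).
  { rewrite Ew. lia. }
  destruct (@scn_A T lt Hom tau Htau cov A X HX HR (S L) q w Xu) as (v & Hv & E2).
  { rewrite Ew'. lia. }
  fold u in E1, E2.
  assert (Hlu : length (A u L) + 1 = tm tau l1).
  { apply (f_equal (@length T)) in E1. rewrite length_app in E1. cbn in E1. rewrite Ew in E1. lia. }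
  assert (Eu : A u (S l1) = A u L) by (apply (A_const Htau HR); auto; lia).
  exists u, v. split; [exact Xu|]. split; [|split; [|split; [exact E2|lia]]].
  - apply (st_stay); auto. apply (A_gap Htau HR) with (S l1); auto; [lia|]. rewrite Eu. lia.
  - transitivity (dn tau (S l1) k1 (dn tau (S L) (S l1) (u :: A u (S L)))).
    { symmetry. apply dn_trans; lia. }
    rewrite (stay_dn Htau HR); auto; [|lia|rewrite Eu; lia].
    rewrite dn_S by lia. rewrite Eu, E1, Ew, Es'.
    replace (v1 ++ w :: v0 ++ s0) with ((v1 ++ w :: v0) ++ s0) by now rewrite <- app_assoc.
    (* At level [S l1] the list consists of the root [s0] and the tail of one full block, so it
       projects to [s0]. This is what permits the jump. *)
    rewrite pr_bottom with (i := 1); auto.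
    apply (f_equal (@length T)) in E1. rewrite Ew, Es', app_comm_cons, app_assoc, length_app in E1.
    cbn [length] in E1. lia.
Qed.

Lemma st_top k s : st tau A X k s -> s = [] \/ exists z, s = z :: A z k /\ In z s /\ X z.
Proof. intros [[->|(z & Hz & ->)] _]; [now left|]. right. exists z. cbn. auto. Qed.

Lemma st_below k s x : st tau A X k s -> In x s -> X x.
Proof.
  intros [[->|(z & Hz & ->)] _]; [contradiction|]. intros [<-|H]; auto.
  now apply (in_A Hom HX HR Hz H).
Qed.

(** Over a point [y] above [s] and [Z], a quiet stretch provides a root containing both, and the
    block that starts at [sc lt y] carries the path there. This is the source of cofinality. *)
Lemma jump k s Z : st tau A X k s -> (forall x, In x Z -> X x) ->
  exists k' u, k < k' /\ X u /\ st tau A X k' (u :: A u k') /\ dn tau k' k (u :: A u k') = s /\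
    incl Z (u :: A u k').
Proof.
  intros Hs HZ.
  destruct (@limit_list_bounded _ _ Hom d (s ++ Z) Hd) as (y & Hy & Hb).
  { intros x Hx. apply in_app_or in Hx as [Hx|Hx]; [exact (st_below Hs Hx)|exact (HZ x Hx)]. }
  destruct (A_all HR k Hy Hb) as (K & HK & Hin).
  destruct (quiet_stretch K Hy) as (L0 & L & h1 & h2 & h3 & h4 & h5 & h6).
  pose proof (cov_gt Hcov L0).
  assert (HinL : incl (s ++ Z) (A y L0)) by (apply Hin; lia).
  destruct (@carrier k s L0 L (sc lt y) 0 (y :: A y L0)) as (u & v & g1 & g2 & g3 & g4 & _); auto.
  - lia.
  - destruct (st_top Hs) as [->|(z & E & Hz & _)]; auto. right. exists z. split; auto.
    right. apply HinL, in_or_app. now left.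
  - now apply (sc_lt_limit Hom).
  - cbn. lia.
  - cbn. lia.
  - rewrite h6. cbn. lia.
  - pose proof (nb_ge2 Htau L). lia.
  - exists (S L), u. repeat split; auto; try lia; try apply g2.
    intros x Hx. rewrite g4, h6. apply in_or_app. right. right. right. apply HinL, in_or_app. now right.
Qed.

Lemma extend_gap k s c : st tau A X k s ->
  exists k' s', k < k' /\ st tau A X k' s' /\ dn tau k' k s' = s /\
    exists k0, c <= k0 /\ k' = cov (cov k0) /\ length s' + c < tm tau k0.
Proof.
  intros Hs. destruct (@jump k s [] Hs) as (k' & u & h1 & h2 & h3 & h4 & _); [contradiction|].
  (* The 1 accounts for the top [u] of the state, and [k'] places the gap beyond the jump. *)
  destruct (row_gap (HR h2) (c + 1 + k')) as (k0 & g1 & g2).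
  pose proof (cov_gt Hcov k0). pose proof (cov_gt Hcov (cov k0)).
  assert (h5 : length (A u k') + 1 < tm tau k') by (destruct h3 as [_ h3]; cbn in h3; lia).
  exists (cov (cov k0)), (u :: A u (cov (cov k0))). split; [lia|]. split.
  - apply st_stay; auto. apply (A_gap Htau HR) with k'; auto; lia.
  - split.
    + rewrite <- (@dn_trans tau T k k') by lia. rewrite (stay_dn Htau HR); auto. lia.
    + exists k0. repeat split; cbn; lia.
Qed.

(** Here [s1] is the state of the path and [s] the state under test. With no blocks to fill, a root
    reachable from [s] and containing [R] suffices; it is made to contain [s1] too, so that the path
    can be carried above it. *)
Lemma extend_capt_0 kn R k s k1 s1 : st tau A X k1 s1 -> st tau A X k s ->
  (forall x, In x R -> X x) ->
  exists L s', k1 < S L /\ st tau A X (S L) s' /\ dn tau (S L) k1 s' = s1 /\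
    capt lt tau cov A d kn 0 R k s L s'.
Proof.
  intros Hs1 Hs HRd.
  destruct (@jump k s (R ++ s1) Hs) as (ka & u & h1 & h2 & h3 & h4 & h5).
  { intros x Hx. apply in_app_or in Hx as [Hx|Hx]; [exact (HRd x Hx)|exact (st_below Hs1 Hx)]. }
  destruct (quiet_stretch (max ka k1) h2) as (L0 & L & g1 & g2 & g3 & g4 & g5 & g6).
  pose proof (cov_gt Hcov L0).
  assert (h6 : length (A u ka) + 1 < tm tau ka) by (destruct h3 as [_ h3]; cbn in h3; lia).
  assert (Hin : incl (R ++ s1) (u :: A u L0)).
  { intros x Hx. destruct (h5 x Hx) as [->|Hx']; [now left|right].
    apply (A_mono HR) with ka; auto. lia. }
  destruct (@carrier k1 s1 L0 L (sc lt u) 0 (u :: A u L0)) as (t & v & f1 & f2 & f3 & f4 & f5); auto.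
  - lia.
  - destruct (st_top Hs1) as [->|(z & E & Hz & _)]; auto. right. exists z. split; auto.
    apply Hin, in_or_app. now right.
  - now apply (sc_lt_limit Hom).
  - cbn. lia.
  - cbn. lia.
  - rewrite g6. cbn. lia.
  - pose proof (nb_ge2 Htau L). lia.
  - exists L, (t :: A t (S L)). split; [lia|]. split; [exact f2|]. split; [exact f3|].
    exists L0, (u :: A u L0), (v ++ [sc lt u]), (fun _ => []).
    split; [|split; [|split]].
    + split; [lia|]. split; [apply st_stay; auto; lia|].
      rewrite <- (@dn_trans tau T k ka) by lia. rewrite (stay_dn Htau HR); auto. lia.
    + split; [lia|]. split; [cbn; lia|]. intros x Hx. apply Hin, in_or_app. now left.
    + split; [rewrite f4, g6, <- app_assoc; reflexivity|].
      apply Nat.div_small. rewrite length_app. cbn. lia.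
    + intros i Hi. lia.
Qed.

End Below.

(** * Capturing one more block *)

Section Step.
Variables (T : Type) (lt : T -> T -> Prop).
Hypothesis Hom : omega1 lt.
Variable tau : type_seq.
Hypothesis Htau : is_type tau.
Variable cov : nat -> nat.
Hypothesis Hcov : covers tau cov.
Variable dc : T -> nat -> list T * T.
Variables (A : T -> nat -> list T) (d : T).
Hypothesis Hd : is_limit lt d.
Let X := fun x => lt x d.
Hypothesis HR : forall x, X x -> row lt tau cov A x (A x).
Let HX : forall x y, lt y x -> X x -> X y := fun x y h1 h2 => o_trans Hom y x d h1 h2.

Lemma list_max (l : list T) : l <> [] -> exists y, In y l /\ forall x, In x l -> x = y \/ lt x y.
Proof.
  induction l as [|a l IH]; [congruence|]. intros _. destruct l as [|b l].
  - exists a. split; [now left|]. intros x [<-|[]]. now left.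
  - destruct IH as (y & Hy & H); [discriminate|].
    destruct (o_total Hom a y) as [h|[->|h]].
    + exists y. split; [now right|]. intros x [<-|Hx]; auto.
    + exists y. split; [now left|]. intros x [<-|Hx]; auto.
    + exists a. split; [now left|]. intros x [<-|Hx]; [now left|]. right.
      destruct (H x Hx) as [->|h']; auto. exact (o_trans Hom _ _ _ h' h).
Qed.

Lemma st_weaken (Y Z : T -> Prop) k s : (forall x, In x s -> Y x -> Z x) ->
  st tau A Y k s -> st tau A Z k s.
Proof.
  intros H [[->|(z & Hz & ->)] Hs]; split; auto. right. exists z. split; auto.
  apply H; auto. now left.
Qed.

Lemma dn_incl k k' (s : list T) : incl (dn tau k' k s) s.
Proof.
  revert s. induction k' as [|k' IH]; intros s; [apply incl_refl|]. cbn [dn].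
  destruct (k <=? k'); [|apply incl_refl]. intros x Hx. apply IH in Hx. now apply pr_incl in Hx.
Qed.

(** Below a guessed [g] above both states, the tested state [s] is extended until it contains [R]
    and the path state [s1]. The capture by [g], applied to this extension, yields a root from which
    the path can enter the block after that of [g]. *)
Lemma extend_capt_S b R k s k1 s1 : st tau A X k1 s1 -> st tau A X k s ->
  (forall x, In x R -> X x) -> (exists M, forall j, M <= j -> b + 2 <= nb tau j) ->
  guess lt tau cov dc A d b R ->
  exists L s', k1 < S L /\ st tau A X (S L) s' /\ dn tau (S L) k1 s' = s1 /\
    capt lt tau cov A d (known lt dc d) (S b) R k s L s'.
Proof.
  intros Hs1 Hs HRd [M HM] HG.
  destruct (@limit_list_bounded _ _ Hom d (s ++ s1) Hd) as (y & Hy & Hb).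
  { intros x Hx. apply in_app_or in Hx as [Hx|Hx];
    [exact (st_below Hom HR Hs Hx)|exact (st_below Hom HR Hs1 Hx)]. }
  destruct (HG y Hy) as (i & (Hyg & Hgd & Hg) & HRg & Hcap & D' & ED & ND & HD).
  set (g := snd (dc d i)) in *.
  assert (HRow : forall x, lt x g -> row lt tau cov A x (A x)) by (intros x Hx; exact (HR (HX Hx Hgd))).
  assert (Hbg : forall x, In x (s ++ s1) -> lt x g)
    by (intros x Hx; exact (o_trans Hom _ _ _ (Hb x Hx) Hyg)).
  assert (Hsg : st tau A (fun x => lt x g) k s).
  { apply st_weaken with X; auto. intros x Hx _. apply Hbg, in_or_app. now left. }
  destruct (@jump T lt Hom tau Htau cov Hcov A g Hg HRow k s (R ++ s1) Hsg)
    as (ka & u & h1 & h2 & h3 & h4 & h5).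
  { intros x Hx. apply in_app_or in Hx as [Hx|Hx]; auto. apply Hbg, in_or_app. now right. }
  destruct (list_max ND) as (y' & Hy' & Hmax).
  assert (Xy' : X y') by (apply HD; auto).
  (* Once the row of the maximum [y'] of the tail contains [g] and the rest of the tail, all these
     points share the block of [g]. *)
  pose (below := filter (fun x => if excluded_middle_informative (lt x y') then true else false) (g :: D')).
  assert (Hbelow : forall x, In x below <-> In x (g :: D') /\ lt x y').
  { intros x. unfold below. rewrite filter_In. destruct (excluded_middle_informative (lt x y'));
    intuition congruence. }
  destruct (@A_all T lt tau cov A X HR 0 y' below Xy') as (K & _ & HK).
  { intros x Hx. now apply Hbelow in Hx. }
  (* From [kb] on, both states have been left behind, the row of [y'] contains [below], and there
     are at least [b + 2] blocks. *)
  pose (kb := max (max ka K) (max k1 M)).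
  assert (h6 : length (A u ka) + 1 < tm tau ka) by (destruct h3 as [_ h3]; cbn in h3; lia).
  assert (Xu : X u) by exact (HX h2 Hgd).
  assert (Hst : st tau A (fun x => lt x g) kb (u :: A u kb)).
  { apply st_stay; auto. apply (A_gap Htau HR) with ka; auto. lia. }
  destruct (Hcap kb _ Hst) as (L & L0 & s' & v & Ds & (g1 & g2 & g3) & (g4 & g5 & g6) & (g7 & g8) & g9).
  pose proof (cov_gt Hcov L0) as Hcv.
  assert (Hkbs : incl (u :: A u kb) s') by (rewrite <- g3; apply dn_incl).
  assert (Hin : incl (R ++ s1) s').
  { intros x Hx. apply Hkbs. destruct (h5 x Hx) as [->|Hx']; [now left|right].
    apply (A_mono HR) with ka; auto. lia. }
  assert (Es : dn tau L0 k s' = s).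
  { rewrite <- h4. rewrite <- (@dn_trans tau T k ka L0) by lia. f_equal.
    rewrite <- (@dn_trans tau T ka kb L0) by lia. rewrite g3. apply (stay_dn Htau HR); auto. lia. }
  pose proof (tm_split Htau L) as [M4 M5]. pose proof (tm_S Htau L) as M8.
  assert (M10 : b + 2 <= nb tau L) by (apply HM; lia).
  assert (M9 : (b + 2) * tl tau L <= tl tau L * nb tau L)
    by (rewrite Nat.mul_comm; apply Nat.mul_le_mono_l; lia).
  assert (Hlg : length (A g (S L)) = length v + rt tau L) by (rewrite g7, length_app; lia).
  assert (Hgy' : g = y' \/ lt g y').
  { destruct (HD y' Hy') as [[<-|h] _]; auto. }
  assert (HDL : forall x, In x (g :: D') -> x = y' \/ In x (A y' L)).
  { intros x Hx. assert (hx : x = y' \/ lt x y') by (destruct Hx as [<-|Hx]; auto).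
    destruct hx as [hx|hx]; auto. right. apply (HK L); [lia|]. now apply Hbelow. }
  assert (Hblock : forall x, In x D' -> rt tau L <= length (A x (S L)) /\
    (length (A x (S L)) - rt tau L) / tl tau L = b).
  { intros x Hx. assert (Xx : X x) by (apply HD; auto).
    destruct (proj1 (HD x Hx)) as [->|hgx].
    - fold g. rewrite Hlg. replace (length v + rt tau L - rt tau L) with (length v) by lia. split; [lia|auto].
    - assert (Hgx : In g (A x L)).
      { destruct (HDL x (or_intror Hx)) as [->|hx]; destruct (HDL g (or_introl eq_refl)) as [e|hg'].
        - rewrite e in hgx. destruct (o_irrefl Hom _ hgx).
        - exact hg'.
        - exfalso. apply (A_lt Hom HX HR Xy') in hx. rewrite e in hgx.
          exact (lt_asym Hom _ _ hgx hx).
        - exact (A_linear Hom HX HR Xy' hx hg' hgx). }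
      assert (Hgx' : In g (A x (S L))) by (apply (A_mono HR) with L; auto).
      apply (A_length_lt Hom HX HR Xx) in Hgx'. split; [lia|].
      rewrite <- (in_A_block Hom Htau HX HR Xx Hgx) by lia. rewrite Hlg.
      replace (length v + rt tau L - rt tau L) with (length v) by lia. exact g8. }
  destruct (Hblock y' Hy') as [B1 B2].
  pose proof (Nat.div_mod_eq (length (A y' (S L)) - rt tau L) (tl tau L)) as B3. rewrite B2 in B3.
  pose proof (Nat.mod_upper_bound (length (A y' (S L)) - rt tau L) (tl tau L)) as B4.
  set (q := (length (A y' (S L)) - rt tau L) mod tl tau L) in *.
  (* As [y'] has offset [q] in block [b], this [w] is the first point of block [S b]. *)
  pose (w := scn lt (tl tau L - q) y').
  assert (Xw : X w) by (apply (scn_lt_limit Hom); auto).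
  destruct (@scn_A T lt Hom tau Htau cov A X HX HR (S L) (tl tau L - q) y' Xw) as (u0 & Hu0 & E0).
  { nia. }
  fold w in E0.
  destruct u0 as [|w0 u0]; [cbn in Hu0; lia|]. injection E0 as <- E0.
  assert (Hlw : length (A w (S L)) = rt tau L + S b * tl tau L).
  { rewrite E0, length_app. cbn [length] in *. nia. }
  assert (Hyg' : exists u1, y' :: A y' (S L) = u1 ++ g :: v ++ s').
  { rewrite <- g7. destruct Hgy' as [<-|h]; [now exists []|].
    assert (hg' : In g (A y' (S L))).
    { apply (A_mono HR) with L; auto. destruct (HDL g (or_introl eq_refl)) as [e|hg']; auto.
      exfalso. rewrite e in h. exact (o_irrefl Hom _ h). }
    destruct (in_A Hom HX HR Xy' hg') as ([u1 E] & _). exists (y' :: u1). now rewrite E. }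
  destruct Hyg' as (u1 & E1).
  (* Between the root and [w] there are exactly the tails of the blocks [0 .. b], so one level lower
     only the root remains. *)
  assert (EwL : A w L = s').
  { rewrite <- (row_pr (HR Xw)). rewrite E0, E1.
    replace (u0 ++ u1 ++ g :: v ++ s') with ((u0 ++ u1 ++ g :: v) ++ s')
      by (rewrite <- !app_assoc; reflexivity).
    apply pr_bottom with (i := S b); auto.
    apply (f_equal (@length T)) in E0. rewrite E1 in E0.
    replace (u0 ++ u1 ++ g :: v ++ s') with ((u0 ++ u1 ++ g :: v) ++ s') in E0
      by (rewrite <- !app_assoc; reflexivity).
    rewrite length_app in E0. lia. }
  destruct (@carrier T lt Hom tau Htau cov Hcov A d Hd HR k1 s1 L0 L w (S b) s')
    as (t & v2 & f1 & f2 & f3 & f4 & f5); auto; try lia.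
  { destruct (st_top Hs1) as [->|(z & E & Hz & _)]; auto. right. exists z. split; auto.
    apply Hin, in_or_app. now right. }
  { apply g2. }
  exists L, (t :: A t (S L)). split; [lia|]. split; [exact f2|]. split; [exact f3|].
  (* Block [b] is filled by the set guessed at [d], the earlier ones by the sets known at [g]. *)
  exists L0, s', (v2 ++ w :: u0 ++ u1 ++ g :: v), (fun j => if j =? b then fst (dc d i) else Ds j).
  assert (E2 : t :: A t (S L) = (v2 ++ w :: u0 ++ u1 ++ g :: v) ++ s').
  { rewrite f4, E0, E1. rewrite <- !app_assoc. cbn. rewrite <- !app_assoc. reflexivity. }
  split; [|split; [|split]].
  - split; [lia|]. split; [|exact Es]. apply st_weaken with (2 := g2).
    intros x _ h. exact (HX h Hgd).
  - repeat split; auto.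
  - split; [exact E2|].
    assert (Hl : length (v2 ++ w :: u0 ++ u1 ++ g :: v) = length v2 + 1 + S b * tl tau L).
    { apply (f_equal (@length T)) in f4. rewrite E2, !length_app in f4.
      rewrite !length_app. cbn [length] in *. rewrite !length_app in *. cbn [length] in *. lia. }
    rewrite Hl, Nat.div_add, Nat.div_small by lia. reflexivity.
  - intros j Hj. destruct (Nat.eqb_spec j b) as [->|Hne].
    + split; [apply known_now|]. exists D'. split; [exact ED|]. split; [exact ND|].
      intros x Hx. destruct (Hblock x Hx). repeat split; auto; [apply HD; auto|].
      rewrite f4. apply in_or_app. right. right. rewrite E0. apply in_or_app. right.
      destruct (HDL x (or_intror Hx)) as [->|hx]; [now left|right]. apply (A_mono HR) with L; auto.
    + destruct (g9 j) as (Hk & D'' & ED' & ND' & HD'); [lia|].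
      split; [now apply known_before with i|]. exists D''. split; [exact ED'|]. split; [exact ND'|].
      intros x Hx. destruct (HD' x Hx) as (q1 & q2 & q3 & q4). repeat split; auto.
      * exact (HX q1 Hgd).
      * rewrite E2. rewrite g7 in q2. apply in_app_or in q2 as [q2|q2]; apply in_or_app; auto.
        left. apply in_or_app. right. right. apply in_or_app. right. apply in_or_app. right. now right.
Qed.

End Step.

(** * Construction of the rows *)

(** A Rasiowa-Sikorski argument: countably many dense requirements are met one after another, and
    the path is read off by projecting the resulting chain of states. *)
Lemma generic_path (T : Type) (tau : type_seq) (St : nat -> list T -> Prop) (I : Type)
  (valid : I -> Prop) (Req : I -> nat -> list T -> Prop) :
  countable_set valid -> (exists i, valid i) -> St 0 [] ->
  (forall k k' s, k <= k' -> St k' s -> St k (dn tau k' k s)) ->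
  (forall i k s, valid i -> St k s ->
    exists k' s', k < k' /\ St k' s' /\ dn tau k' k s' = s /\ Req i k' s') ->
  exists P, (forall k, St k (P k)) /\ (forall k, pr tau k (P (S k)) = P k) /\
    forall i, valid i -> exists k, Req i k (P k).
Proof.
  intros [code Hcode] [i0 Hi0] H0 Hdn Hext.
  pose (state := {p : nat * list T | St (fst p) (snd p)}).
  pose (next (j : nat) (p p' : state) :=
    fst (proj1_sig p) < fst (proj1_sig p') /\
    dn tau (fst (proj1_sig p')) (fst (proj1_sig p)) (snd (proj1_sig p')) = snd (proj1_sig p) /\
    forall i, valid i -> code i = j -> Req i (fst (proj1_sig p')) (snd (proj1_sig p'))).
  assert (Hnext : forall j p, exists p', next j p p').
  { intros j [[k s] Hp]. cbn in Hp.
    (* If no requirement has code [j], the default [i0] is served, so that the level still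
       increases. *)
    assert (Hj : exists i, valid i /\ forall i', valid i' -> code i' = j -> i' = i).
    { destruct (classic (exists i, valid i /\ code i = j)) as [(i & Hi & <-)|N].
      - exists i. split; auto.
      - exists i0. split; auto. intros i' Hi' E. exfalso. apply N. eauto. }
    destruct Hj as (i & Hi & Hu). destruct (Hext i k s Hi Hp) as (k' & s' & h1 & h2 & h3 & h4).
    exists (exist _ (k', s') h2). repeat split; auto. intros i' Hi' E. now rewrite (Hu i' Hi' E). }
  pose (f j p := proj1_sig (constructive_indefinite_description _ (Hnext j p))).
  assert (Hf : forall j p, next j p (f j p))
    by (intros j p; exact (proj2_sig (constructive_indefinite_description _ (Hnext j p)))).
  pose (path := fix path j : state := match j with 0 => exist _ (0, []) H0 | S j' => f j' (path j') end).
  pose (lv j := fst (proj1_sig (path j))). pose (ls j := snd (proj1_sig (path j))).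
  assert (Hst : forall j, St (lv j) (ls j)) by (intros j; exact (proj2_sig (path j))).
  assert (Hstep : forall j, lv j < lv (S j) /\ dn tau (lv (S j)) (lv j) (ls (S j)) = ls j).
  { intros j. destruct (Hf j (path j)) as (h1 & h2 & _). auto. }
  assert (Hge : forall j, j <= lv j).
  { induction j as [|j IH]; [lia|]. pose proof (Hstep j). lia. }
  assert (Hmono : forall j j', j <= j' -> lv j <= lv j' /\ dn tau (lv j') (lv j) (ls j') = ls j).
  { intros j j' H. induction H as [|j' H [IH1 IH2]]; [split; auto; apply dn_refl|].
    destruct (Hstep j') as [h1 h2]. split; [lia|]. rewrite <- (@dn_trans tau T (lv j) (lv j')) by lia.
    now rewrite h2. }
  pose (P k := dn tau (lv k) k (ls k)).
  assert (HP : forall k j, k <= lv j -> dn tau (lv j) k (ls j) = P k).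
  { intros k j Hk. unfold P. destruct (le_ge_dec j k) as [h|h];
    destruct (Hmono _ _ h) as [h1 h2]; rewrite <- h2;
    [|symmetry]; apply dn_trans; auto. }
  exists P. split; [|split].
  - intros k. apply Hdn; auto.
  - intros k. rewrite <- (HP k (S k)) by (specialize (Hge (S k)); lia).
    unfold P. apply pr_dn. specialize (Hge (S k)). lia.
  - intros i Hi. exists (lv (S (code i))). rewrite <- (HP _ (S (code i))) by lia. rewrite dn_refl.
    destruct (Hf (code i) (path (code i))) as (_ & _ & h). now apply h.
Qed.

Inductive task (T : Type) : Type :=
| Cover (y : T)
| Gap (c : nat)
| Capture (b : nat) (R : list T) (k : nat) (s : list T).

(** * Existence of a row over the rows below *)

Section Existence.
Variables (T : Type) (lt : T -> T -> Prop).
Hypothesis Hom : omega1 lt.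
Variable tau : type_seq.
Hypothesis Htau : is_type tau.
Variable cov : nat -> nat.
Hypothesis Hcov : covers tau cov.
Variable dc : T -> nat -> list T * T.
Variables (A : T -> nat -> list T) (d : T).
Let X := fun x => lt x d.
Hypothesis HS : forall x, X x -> spec lt tau cov dc A x (A x).
Let HX : forall x y, lt y x -> X x -> X y := fun x y h1 h2 => o_trans Hom y x d h1 h2.

Lemma rows_below x : X x -> row lt tau cov A x (A x).
Proof. intros Hx. apply (HS Hx). Qed.

Lemma spec_of_row P : ~ is_limit lt d -> row lt tau cov A d P -> spec lt tau cov dc A d P.
Proof. intros N H. split; [exact H|contradiction]. Qed.

Lemma spec_least : (forall y, ~ lt y d) -> exists P, spec lt tau cov dc A d P.
Proof.
  intros N. exists (fun _ => []). apply spec_of_row.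
  - intros [[y Hy] _]. exact (N y Hy).
  - constructor.
    + intros k. now left.
    + intros k. pose proof (tm_gt Htau k). cbn. lia.
    + intros k. apply (pr_small Htau). pose proof (tm_gt Htau k). cbn. lia.
    + intros y Hy. destruct (N y Hy).
    + intros c. exists c. pose proof (tm_gt Htau c). cbn. split; lia.
Qed.

(** From level [K] on the row waits at [z]; the lower levels are projections of its value there. *)
Lemma spec_successor z : lt z d -> (forall y, lt y d -> y = z \/ lt y z) ->
  exists P, spec lt tau cov dc A d P.
Proof.
  intros Hz Hd. pose proof (rows_below Hz) as Rz.
  destruct (row_gap Rz 1) as (k0 & _ & Hg).
  pose (K := cov (cov k0)).
  assert (HK : length (A z K) + 1 < tm tau K).
  { pose proof (cov_gt Hcov k0). pose proof (cov_gt Hcov (cov k0)).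
    pose proof (@tm_le tau Htau k0 K). unfold K in *. lia. }
  assert (HK' : forall k, K <= k -> length (A z k) + 1 < tm tau k)
    by (intros k Hk; apply (A_gap Htau rows_below) with K; auto).
  pose (P k := dn tau (max k K) k (z :: A z (max k K))).
  assert (HPK : forall k, K <= k -> P k = z :: A z k).
  { intros k Hk. unfold P. replace (max k K) with k by lia. apply dn_refl. }
  assert (HP : forall k, st tau A X k (P k)).
  { intros k. apply (st_dn Hom Htau HX rows_below); [lia|]. apply st_stay; auto. apply HK'. lia. }
  exists P. apply spec_of_row.
  - intros [_ H]. destruct (H z Hz) as (y & h1 & h2). destruct (Hd y h2) as [->|h].
    + exact (o_irrefl Hom _ h1).
    + exact (lt_asym Hom _ _ h1 h).
  - constructor.
    + intros k. exact (proj1 (HP k)).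
    + intros k. exact (proj2 (HP k)).
    + intros k. destruct (le_lt_dec K k) as [h|h].
      * rewrite !HPK by lia. apply (stay_pr Htau rows_below); auto.
      * unfold P. replace (max (S k) K) with K by lia. replace (max k K) with K by lia.
        apply pr_dn. exact h.
    + intros y Hy. destruct (Hd y Hy) as [->|h]; [exists K; rewrite HPK by lia; now left|].
      destruct (row_cover Rz h) as [j Hj].
      exists (max j K). rewrite HPK by lia. right. apply (A_mono rows_below) with j; auto. lia.
    (* One extra place is for [z]; the summand [K] puts [k1] where the row is [z] followed by the
       row of [z]. *)
    + intros c. destruct (row_gap Rz (c + 1 + K)) as (k1 & h1 & h2).
      exists k1. split; [lia|]. rewrite HPK; [cbn; lia|].
      pose proof (cov_gt Hcov k1). pose proof (cov_gt Hcov (cov k1)). lia.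
Qed.

Definition task_ok (t : task T) : Prop :=
  match t with
  | Cover y => X y
  | Gap _ _ => True
  | Capture b R k s => (forall x, In x R -> X x) /\ st tau A X k s /\
      match b with
      | 0 => True
      | S b' => (exists M, forall j, M <= j -> b' + 2 <= nb tau j) /\ guess lt tau cov dc A d b' R
      end
  end.

(** The level is prescribed in two cases because [row_gap] inspects the path at [cov (cov k)] and
    [cap] inspects it at [S L]. *)
Definition task_done (t : task T) (k' : nat) (s' : list T) : Prop :=
  match t with
  | Cover y => In y s'
  | Gap _ c => exists k0, c <= k0 /\ k' = cov (cov k0) /\ length s' + c < tm tau k0
  | Capture b R k s => exists L, k' = S L /\ capt lt tau cov A d (known lt dc d) b R k s L s'
  end.

(** A valid task is a finite object made of natural numbers and points below [d], which [seg]
    numbers. *)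
Lemma tasks_countable : countable_set task_ok.
Proof.
  pose (g := seg Hom d). pose (ex l := enc (map g l)).
  assert (Hex : forall l l', (forall x, In x l -> X x) -> (forall x, In x l' -> X x) ->
    ex l = ex l' -> l = l').
  { intros l l' Hl Hl' E. apply enc_inj, map_inj_on in E; auto.
    intros x y Hx Hy. apply (@seg_inj T lt Hom d x y); [exact (Hl x Hx)|exact (Hl' y Hy)]. }
  exists (fun t => match t with
    | Cover y => enc [0; g y]
    | Gap _ c => enc [1; c]
    | Capture b R k s => enc [2; b; ex R; k; ex s]
    end).
  intros [y|c|b R k s] [y'|c'|b' R' k' s'] H H' E; apply enc_inj in E; try discriminate.
  - injection E as E. f_equal. exact (@seg_inj T lt Hom d y y' H H' E).
  - now injection E as ->.
  - injection E as -> E1 -> E2. destruct H as (h1 & h2 & _). destruct H' as (h1' & h2' & _).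
    apply Hex in E1; auto. apply Hex in E2; [now subst| |]; intros x Hx.
    + exact (st_below Hom rows_below h2 Hx).
    + exact (st_below Hom rows_below h2' Hx).
Qed.

Lemma spec_limit : is_limit lt d -> exists P, spec lt tau cov dc A d P.
Proof.
  intros Hd.
  destruct (@generic_path T tau (st tau A X) (task T) task_ok task_done) as (P & h1 & h2 & h3).
  - exact tasks_countable.
  - exists (Gap T 0). exact I.
  - apply (st_nil Htau).
  - intros k k' s. apply (st_dn Hom Htau HX rows_below).
  - intros [y|c|b R k0 s0] k s Ht Hs.
    + destruct (@jump T lt Hom tau Htau cov Hcov A d Hd rows_below k s [y] Hs)
        as (k' & u & g1 & g2 & g3 & g4 & g5).
      { intros x [<-|[]]. exact Ht. }
      exists k', (u :: A u k'). repeat split; auto; try apply g3. apply g5. now left.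
    + exact (@extend_gap T lt Hom tau Htau cov Hcov A d Hd rows_below k s c Hs).
    + destruct Ht as (t1 & t2 & t3). destruct b as [|b].
      * destruct (@extend_capt_0 T lt Hom tau Htau cov Hcov A d Hd rows_below
          (known lt dc d) R k0 s0 k s) as (L & s' & g1 & g2 & g3 & g4); auto.
        exists (S L), s'. repeat split; auto; try apply g2. exists L. auto.
      * destruct t3 as [t3 t4].
        destruct (@extend_capt_S T lt Hom tau Htau cov Hcov dc A d Hd rows_below b R k0 s0 k s)
          as (L & s' & g1 & g2 & g3 & g4); auto.
        exists (S L), s'. repeat split; auto; try apply g2. exists L. auto.
  - exists P. split.
    + constructor.
      * intros k. exact (proj1 (h1 k)).
      * intros k. exact (proj2 (h1 k)).
      * exact h2.
      * intros y Hy. exact (h3 (Cover y) Hy).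
      * intros c. destruct (h3 (Gap T c) I) as (k & k0 & g1 & -> & g2). eauto.
    + intros _ R HRd. split.
      * intros k s Hs. destruct (h3 (Capture 0 R k s)) as (k' & L & -> & g); [cbn; auto|]. eauto.
      * intros b Hb HG k s Hs. destruct (h3 (Capture (S b) R k s)) as (k' & L & -> & g); [cbn; auto|]. eauto.
Qed.

Lemma spec_ex : exists P, spec lt tau cov dc A d P.
Proof.
  destruct (classic (exists y, lt y d)) as [H|H].
  - destruct (classic (is_limit lt d)) as [Hl|Hl]; [now apply spec_limit|].
    destruct (classic (exists z, lt z d /\ forall y, lt y d -> y = z \/ lt y z)) as [(z & h1 & h2)|N].
    + now apply spec_successor with z.
    + exfalso. apply Hl. split; auto. intros y Hy. apply NNPP. intros N'. apply N. exists y.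
      split; auto. intros x Hx. apply (nlt Hom). intros h. apply N'. eauto.
  - apply spec_least. intros y Hy. apply H. eauto.
Qed.

End Existence.

(** * Recursion along the ordinals *)

Section Recursion.
Variables (T : Type) (lt : T -> T -> Prop).
Hypothesis Hom : omega1 lt.
Variable tau : type_seq.
Hypothesis Htau : is_type tau.
Variable cov : nat -> nat.
Hypothesis Hcov : covers tau cov.
Variable dc : T -> nat -> list T * T.

Definition agree (d : T) (A A' : T -> nat -> list T) : Prop := forall x, lt x d -> A x = A' x.

Lemma agree_sym d A A' : agree d A A' -> agree d A' A.
Proof. intros H x Hx. symmetry. auto. Qed.

Lemma agree_below d g A A' : lt g d -> agree d A A' -> agree g A A'.
Proof. intros Hg H x Hx. apply H. exact (o_trans Hom _ _ _ Hx Hg). Qed.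

Lemma row_ext A A' d P : agree d A A' -> row lt tau cov A d P -> row lt tau cov A' d P.
Proof.
  intros H [h1 h2 h3 h4 h5]. constructor; auto.
  intros k. destruct (h1 k) as [E|(b & Hb & E)]; [now left|right].
  exists b. now rewrite <- (H b Hb).
Qed.

Lemma st_ext A A' d k s : agree d A A' ->
  st tau A (fun x => lt x d) k s -> st tau A' (fun x => lt x d) k s.
Proof.
  intros H [[->|(b & Hb & ->)] Hs]; split; auto. right. exists b. now rewrite <- (H b Hb).
Qed.

Lemma capt_ext A A' d kn b R k s L p : agree d A A' ->
  capt lt tau cov A d kn b R k s L p -> capt lt tau cov A' d kn b R k s L p.
Proof.
  intros H (L0 & s' & v & Ds & (h1 & h2 & h3) & h4 & h5 & h6).
  exists L0, s', v, Ds. split; [|split; [exact h4|split; [exact h5|]]].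
  - split; [exact h1|]. split; [now apply st_ext with A|exact h3].
  - intros i Hi. destruct (h6 i Hi) as (Hk & D' & E & ND & HD). split; [exact Hk|]. exists D'.
    split; [exact E|]. split; [exact ND|]. intros x Hx. destruct (HD x Hx) as (g1 & g2).
    split; [exact g1|]. now rewrite <- (H x g1).
Qed.

Lemma cap_ext A A' d kn b R P : agree d A A' ->
  cap lt tau cov A d kn b R P -> cap lt tau cov A' d kn b R P.
Proof.
  intros H HC k s Hs. destruct (HC k s) as [L HL].
  - apply st_ext with A'; auto. now apply agree_sym.
  - exists L. now apply capt_ext with A.
Qed.

Lemma guess_ext A A' d b R : agree d A A' ->
  guess lt tau cov dc A d b R -> guess lt tau cov dc A' d b R.
Proof.
  intros H HG y Hy. destruct (HG y Hy) as (i & h1 & h2 & h3 & h4). exists i. cbn.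
  split; [exact h1|]. split; [exact h2|]. split; [|exact h4].
  rewrite <- (H (snd (dc d i))) by apply h1. apply cap_ext with A; auto.
  apply agree_below with d; auto. apply h1.
Qed.

(** The requirement at [d] depends only on the rows below [d]; this licenses the recursion. *)
Lemma spec_ext A A' d P : agree d A A' -> spec lt tau cov dc A d P -> spec lt tau cov dc A' d P.
Proof.
  intros H [h1 h2]. split; [now apply row_ext with A|].
  intros Hd R HRd. destruct (h2 Hd R HRd) as [h3 h4]. split.
  - now apply cap_ext with A.
  - intros b Hb HG. apply cap_ext with A; auto. apply h4; auto.
    apply guess_ext with A'; auto. now apply agree_sym.
Qed.

Lemma construction : exists A, forall d, spec lt tau cov dc A d (A d).
Proof.
  (* The rows built so far are completed by empty ones, which by [spec_ext] does not affect the
     requirement at [d]. *)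
  pose (ext d (rec : forall x, lt x d -> nat -> list T) := fun x =>
    match excluded_middle_informative (lt x d) with left h => rec x h | right _ => fun _ => [] end).
  pose (F d rec := epsilon (inhabits (fun _ : nat => @nil T)) (spec lt tau cov dc (ext d rec) d)).
  pose (A := Fix (o_wf Hom) (fun _ => nat -> list T) F).
  assert (HA : forall d, A d = F d (fun x _ => A x)).
  { intros d. apply (Fix_eq (o_wf Hom) (fun _ => nat -> list T) F). intros x f g E.
    replace g with f; auto. extensionality y. extensionality h. apply E. }
  exists A. intros d. induction d as [d IH] using (well_founded_induction (o_wf Hom)).
  assert (Hag : agree d A (ext d (fun x _ => A x))).
  { intros x Hx. unfold ext. destruct (excluded_middle_informative (lt x d)); auto. contradiction. }
  apply spec_ext with (ext d (fun x _ => A x)); [now apply agree_sym|].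
  rewrite HA. apply epsilon_spec.
  destruct (@spec_ex T lt Hom tau Htau cov Hcov dc A d IH) as [P HP].
  exists P. now apply spec_ext with A.
Qed.

End Recursion.

(** Goodness yields each of the finitely many root sizes beyond [k], and the bounds are collected
    one size at a time. The index [j - 1] undoes the shift in [rt]. *)
Lemma covers_exist tau : good_type tau -> exists cov, covers tau cov.
Proof.
  intros [Htau Hg].
  enough (H : forall k, exists c, k < c /\ forall a, a <= tm tau k -> exists j, k <= j < c /\ rt tau j = a).
  { exists (fun k => proj1_sig (constructive_indefinite_description _ (H k))).
    intros k. exact (proj2_sig (constructive_indefinite_description _ (H k))). }
  intros k. generalize (tm tau k) as n. induction n as [|n (c & Hc & IH)].
  - destruct (Hg 0 (S k)) as (j & h1 & h2 & h3). exists (S j). split; [lia|].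
    intros a Ha. exists (j - 1). unfold rt. replace (S (j - 1)) with j by lia. split; lia.
  - destruct (Hg (S n) (S k)) as (j & h1 & h2 & h3). exists (c + S j). split; [lia|].
    intros a Ha. destruct (Nat.eq_dec a (S n)) as [->|N].
    + exists (j - 1). unfold rt. replace (S (j - 1)) with j by lia. split; lia.
    + destruct (IH a) as (i & Hi & E); [lia|]. exists i. split; [lia|exact E].
Qed.

(** * The scheme *)

Lemma StronglySorted_rev (A : Type) (R : A -> A -> Prop) l :
  StronglySorted (fun a b => R b a) l -> StronglySorted R (rev l).
Proof.
  assert (H : forall x l, StronglySorted R l -> Forall (fun y => R y x) l -> StronglySorted R (l ++ [x])).
  { intros x l0 Hl Hx. induction Hl as [|a l0 Hl IH Ha]; cbn; [repeat constructor|].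
    inversion Hx; subst. constructor; auto. apply Forall_app. auto. }
  induction 1 as [|a l Hl IH Ha]; cbn; [constructor|]. apply H; auto. now apply Forall_rev.
Qed.

Definition family (T : Type) (tau : type_seq) (A : T -> nat -> list T) (s : list T) : Prop :=
  exists k x, length (x :: A x k) = tm tau k /\ s = rev (x :: A x k).

Section Scheme.
Variables (T : Type) (lt : T -> T -> Prop).
Hypothesis Hom : omega1 lt.
Variable tau : type_seq.
Hypothesis Htau : is_type tau.
Variable cov : nat -> nat.
Variable A : T -> nat -> list T.
Hypothesis Hrow : forall x, row lt tau cov A x (A x).
Let X := fun _ : T => True.
Let HR : forall x, X x -> row lt tau cov A x (A x) := fun x _ => Hrow x.
Let HX : forall x y, lt y x -> X x -> X y := fun _ _ _ _ => I.
Let F := family tau A.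

Lemma level_family k s : level tau F k s <-> exists x, length (x :: A x k) = tm tau k /\ s = rev (x :: A x k).
Proof.
  split.
  - intros [(k' & x & E & ->) E']. rewrite length_rev, E in E'.
    apply (tm_inj Htau) in E'. subst k'. eauto.
  - intros (x & E & ->). split; [now exists k, x|]. now rewrite length_rev.
Qed.

(** The successors of [x] supply the missing points of the member. *)
Lemma full_above k x : exists t, length (t :: A t k) = tm tau k /\ In x (t :: A t k).
Proof.
  pose (q := tm tau k - 1 - length (A x k)). pose proof (row_len (Hrow x) k) as Hl.
  destruct (@scn_A T lt Hom tau Htau cov A X HX HR k q x I) as (u & Hu & E); [lia|].
  exists (scn lt q x). rewrite E. split.
  - rewrite length_app. cbn. lia.
  - apply in_or_app. right. now left.
Qed.

Lemma in_chain k t x y : In x (t :: A t k) -> In y (t :: A t k) -> lt y x -> In y (A x k).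
Proof.
  intros [<-|Hx] [<-|Hy] Hlt; auto.
  - destruct (o_irrefl Hom _ Hlt).
  - exfalso. apply (A_lt Hom HX HR I) in Hx. exact (lt_asym Hom _ _ Hlt Hx).
  - now apply (A_linear Hom HX HR) with t.
Qed.

Lemma chain_down k t x y : In x (t :: A t k) -> In y (A x k) -> In y (t :: A t k).
Proof.
  intros [<-|Hx] Hy; [now right|]. right. now apply (A_trans Hom HX HR) with x.
Qed.

Lemma chain_split k t x : In x (t :: A t k) -> exists u, t :: A t k = u ++ x :: A x k.
Proof.
  intros [<-|Hx]; [now exists []|]. apply (in_A Hom HX HR I) in Hx as [[u E] _].
  exists (t :: u). now rewrite E.
Qed.

Lemma chain_NoDup k t : NoDup (t :: A t k).
Proof.
  constructor; [|now apply (A_NoDup Hom HX HR)].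
  intros h. apply (A_lt Hom HX HR I) in h. exact (o_irrefl Hom _ h).
Qed.

Lemma chain_lt k t x y : In x (t :: A t k) -> In y (t :: A t k) ->
  length (A y k) < length (A x k) -> lt y x.
Proof.
  intros Hx Hy Hl. destruct (o_total Hom y x) as [h|[->|h]]; [exact h|lia|].
  apply (in_chain Hy Hx), (A_length_lt Hom HX HR I) in h. lia.
Qed.

Lemma chain_length k t x : In x (t :: A t k) -> length (A x k) <= length (A t k).
Proof. intros [<-|Hx]; [lia|]. apply (A_length_lt Hom HX HR I) in Hx. lia. Qed.

Lemma chain_nth k t j : j <= length (A t k) -> exists x, In x (t :: A t k) /\ length (A x k) = j.
Proof.
  intros Hj. destruct (skipn (length (A t k) - j) (t :: A t k)) as [|x v] eqn:E.
  - apply (f_equal (@length T)) in E. rewrite length_skipn in E. cbn [length] in E. lia.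
  - pose proof (firstn_skipn (length (A t k) - j) (t :: A t k)) as E1. rewrite E in E1. symmetry in E1.
    destruct (suffix_A Hom HX HR I E1) as (-> & _). exists x. split.
    + rewrite E1. apply in_or_app. right. now left.
    + apply (f_equal (@length T)) in E. rewrite length_skipn in E. cbn [length] in E. lia.
Qed.

Lemma in_pr_of_block k (u v : list T) y : length v < rt tau k \/
  rt tau k <= length v /\
  (length v - rt tau k) / tl tau k = (length (u ++ y :: v) - rt tau k) / tl tau k ->
  In y (pr tau k (u ++ y :: v)).
Proof.
  unfold pr. set (n := length (u ++ y :: v)).
  assert (Hn : n = length u + 1 + length v) by (unfold n; rewrite length_app; cbn; lia).
  clearbody n. destruct (tm_split Htau k) as [_ Ht].
  intros [H|[H E]]; apply in_or_app; [right|left].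
  - rewrite skipn_app. apply in_or_app. right. replace (n - rt tau k - length u) with 0 by lia. now left.
  - pose proof (Nat.div_mod_eq (length v - rt tau k) (tl tau k)) as E1.
    pose proof (Nat.div_mod_eq (n - rt tau k) (tl tau k)) as E2. rewrite E in E1.
    rewrite firstn_app. apply in_or_app. right.
    replace (_ mod _ - length u) with (S ((n - rt tau k) mod tl tau k - length u - 1)) by lia. now left.
Qed.

Lemma in_lower k x y : In y (A x (S k)) -> (In y (A x k) <->
  length (A y (S k)) < rt tau k \/ rt tau k <= length (A y (S k)) /\
  (length (A y (S k)) - rt tau k) / tl tau k = (length (A x (S k)) - rt tau k) / tl tau k).
Proof.
  intros Hy. split.
  - intros H. destruct (le_lt_dec (rt tau k) (length (A y (S k)))) as [h|h]; [right|now left].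
    split; [exact h|]. now apply (in_A_block Hom Htau HX HR I).
  - intros H. destruct (in_A Hom HX HR I Hy) as ([u E] & _).
    rewrite <- (row_pr (Hrow x)), E. apply in_pr_of_block. now rewrite <- E.
Qed.

Lemma decomp_exists k t : length (t :: A t (S k)) = tm tau (S k) ->
  exists blocks R, decomp lt tau F (S k) (rev (t :: A t (S k))) blocks R.
Proof.
  intros Ht. pose proof (tm_S Htau k) as E. pose proof (tm_split Htau k) as [E1 E2].
  pose proof (nb_ge2 Htau k) as E3.
  (* The length of its row is the position of a point in the member; positions from [rt tau k] on
     are cut into blocks of length [tl tau k]. *)
  pose (p := t :: A t (S k)). pose (pos x := length (A x (S k))).
  pose (bl x := (pos x - rt tau k) / tl tau k).
  (* The last point of block [i], whose level [k] row completes to the whole block. The bound on [i]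
     stands under the quantifier so that choice gives a total function. *)
  assert (Htop : forall i, exists y, i < nb tau k -> In y p /\ pos y = rt tau k + (i * tl tau k + (tl tau k - 1))).
  { intros i. destruct (le_lt_dec (nb tau k) i) as [h|h]; [exists t; lia|].
    destruct (@chain_nth (S k) t (rt tau k + (i * tl tau k + (tl tau k - 1)))) as (y & Hy); [|eauto].
    assert ((i + 1) * tl tau k <= tl tau k * nb tau k)
      by (rewrite Nat.mul_comm; apply Nat.mul_le_mono_l; lia). cbn [length] in Ht. lia. }
  pose (top i := proj1_sig (constructive_indefinite_description _ (Htop i))).
  assert (Htop' : forall i, i < nb tau k ->
    In (top i) p /\ pos (top i) = rt tau k + (i * tl tau k + (tl tau k - 1)))
    by (intros i; exact (proj2_sig (constructive_indefinite_description _ (Htop i)))).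
  assert (Hbl : forall i, i < nb tau k -> bl (top i) = i).
  { intros i Hi. unfold bl. rewrite (proj2 (Htop' i Hi)).
    replace (rt tau k + _ - rt tau k) with (tl tau k - 1 + i * tl tau k) by lia.
    rewrite Nat.div_add, Nat.div_small by lia. reflexivity. }
  assert (Hin : forall i, i < nb tau k -> forall y, In y (rev (top i :: A (top i) k)) <->
    In y p /\ (pos y < rt tau k \/ rt tau k <= pos y /\ bl y = i)).
  { intros i Hi y. destruct (Htop' i Hi) as [Hp Hpos]. specialize (Hbl i Hi). rewrite <- in_rev. split.
    - intros [<-|Hy].
      + split; [exact Hp|]. right. split; [lia|exact Hbl].
      + assert (Hy' : In y (A (top i) (S k))) by (apply (A_mono HR) with k; [exact I|lia|exact Hy]).
        split; [now apply chain_down with (top i)|].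
        apply (in_lower Hy') in Hy. fold (pos y) (pos (top i)) in Hy. unfold bl in *. rewrite Hbl in Hy. exact Hy.
    - intros [Hy H]. destruct (o_total Hom y (top i)) as [h|[->|h]]; [|now left|exfalso].
      + right. apply (in_chain Hp Hy) in h. apply (in_lower h). fold (pos y) (pos (top i)).
        unfold bl in *. now rewrite Hbl.
      + apply (in_chain Hy Hp), (A_length_lt Hom HX HR I) in h. fold (pos y) (pos (top i)) in h.
        destruct H as [H|[H H']]; [lia|]. unfold bl in H'.
        pose proof (Nat.div_mod_eq (pos y - rt tau k) (tl tau k)) as E4. rewrite H' in E4.
        pose proof (Nat.mod_upper_bound (pos y - rt tau k) (tl tau k)). lia. }
  pose (R := skipn (tm tau (S k) - rt tau k) p).
  assert (HRin : forall y, In y R <-> In y p /\ pos y < rt tau k).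
  { intros y. unfold R. split.
    - intros Hy. assert (Hp : In y p).
      { rewrite <- (firstn_skipn (tm tau (S k) - rt tau k) p). apply in_or_app. now right. }
      split; [exact Hp|]. destruct (chain_split Hp) as [u Eu]. fold p in Eu. rewrite Eu in Hy.
      apply in_skipn_ge in Hy; [|rewrite <- Eu; apply chain_NoDup].
      apply (f_equal (@length T)) in Eu. rewrite length_app in Eu. unfold p in Eu. rewrite Ht in Eu.
      cbn [length] in Eu. unfold pos. lia.
    - intros [Hp Hy]. destruct (chain_split Hp) as [u Eu]. fold p in Eu.
      pose proof (f_equal (@length T) Eu) as El. rewrite length_app in El. unfold p in El. rewrite Ht in El.
      cbn [length] in El. unfold pos in Hy. rewrite Eu, skipn_app. apply in_or_app. right.
      replace (_ - _ - _) with 0 by lia. now left. }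
  exists (fun i => rev (top i :: A (top i) k)), R.
  assert (Hout : forall i y, i < nb tau k -> In y (rev (top i :: A (top i) k)) -> ~ In y R ->
    In y p /\ rt tau k <= pos y /\ bl y = i).
  { intros i y Hi Hy HyR. apply (Hin i Hi) in Hy as [Hp [H|[H H']]]; auto.
    exfalso. apply HyR, HRin. auto. }
  assert (Hlen : forall i, i < nb tau k -> length (top i :: A (top i) k) = tm tau k).
  { intros i Hi. cbn [length]. destruct (Htop' i Hi) as [Hp Hpos]. unfold pos in Hpos.
    rewrite <- (row_pr (Hrow (top i))), pr_length by (trivial; lia). rewrite Hpos.
    replace (rt tau k + _ - rt tau k) with (tl tau k - 1 + i * tl tau k) by lia.
    rewrite Nat.Div0.mod_add, Nat.mod_small by lia. lia. }
  unfold decomp, rtt. change (tn tau (S k)) with (nb tau k). split; [|split; [|split]].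
  - split; [exact E3|]. split; [|split; [|split; [|split]]].
    + pose proof (chain_NoDup (S k) t) as Hn. fold p in Hn.
      rewrite <- (firstn_skipn (tm tau (S k) - rt tau k) p) in Hn. fold R in Hn.
      now apply NoDup_app_remove_l in Hn.
    + intros i Hi. rewrite length_rev. replace (S k - 1) with k by lia. now apply Hlen.
    + intros i j Hij Hj x. rewrite (Hin i), (Hin j), HRin by (trivial; lia).
      clearbody bl pos. intuition lia.
    + intros i Hi x y Hx Hy HyR. destruct (Hout i y Hi Hy HyR) as (Hp & H & _).
      apply HRin in Hx as [Hx Hx']. apply (chain_lt Hp Hx). fold (pos x) (pos y). lia.
    + intros i j Hij Hj x y Hx HxR Hy HyR.
      destruct (Hout i x) as (Hp & H & Hb); auto; [lia|].
      destruct (Hout j y) as (Hp' & H' & Hb'); auto.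
      apply (chain_lt Hp' Hp). fold (pos x) (pos y). apply Nat.nle_gt. intros h.
      assert (bl y <= bl x) by (apply Nat.Div0.div_le_mono; lia). lia.
  - unfold R, p. rewrite length_skipn, Ht. unfold rt in *. lia.
  - intros i Hi. replace (S k - 1) with k by lia. apply level_family. exists (top i). auto.
  - intros x. rewrite <- in_rev. fold p. split.
    + intros Hp. destruct (le_lt_dec (rt tau k) (pos x)) as [h|h].
      * assert (Hb : bl x < nb tau k).
        { apply Nat.Div0.div_lt_upper_bound. pose proof (chain_length Hp). cbn [length] in Ht. unfold pos in *. lia. }
        exists (bl x). split; [exact Hb|]. apply Hin; auto.
      * exists 0. split; [lia|]. apply Hin; [lia|]. auto.
    + intros (i & Hi & Hx). now apply Hin in Hx.
Qed.

Lemma family_sorted s : F s -> s <> [] /\ StronglySorted lt s.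
Proof.
  intros (k & x & _ & ->). split.
  - cbn. intros E. apply app_eq_nil in E as [_ E]. discriminate.
  - apply StronglySorted_rev. now apply (A_sorted Hom HX HR).
Qed.

Lemma family_scheme : scheme lt tau F.
Proof.
  split; [exact family_sorted|]. split; [|split; [|split]].
  - intros l. destruct (list_bounded Hom l) as [x Hx].
    destruct (@A_all T lt tau cov A X HR 0 x l I Hx) as (k & _ & Hk).
    destruct (full_above k x) as (t & Ht & Hxt). exists (rev (t :: A t k)). split; [now exists k, t|].
    intros y Hy. apply -> in_rev. apply chain_down with x; auto. apply (Hk k); auto.
  - intros s (k & x & E & ->). exists k. now rewrite length_rev.
  - intros k E G HE HG. apply level_family in HE as (e & _ & ->). apply level_family in HG as (g & _ & ->).
    intros x y Hx Hx'. rewrite <- !in_rev in *. split; intros Hy Hlt.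
    + apply chain_down with x; auto. now apply in_chain with e.
    + apply chain_down with x; auto. now apply in_chain with g.
  - intros k s Hs. apply level_family in Hs as (t & Ht & ->). now apply decomp_exists.
Qed.

(** A common member at a level up to [L] would put [x] into the row of [y] at that level, and rows
    grow with the level. *)
Lemma family_rho L x y : In x (A y (S L)) -> ~ In x (A y L) -> rho_is tau F x y (S L).
Proof.
  intros Hx N. split.
  - destruct (full_above (S L) y) as (t & Ht & Hy). exists (rev (t :: A t (S L))).
    split; [apply level_family; eauto|]. rewrite <- !in_rev. split; [|exact Hy]. now apply chain_down with y.
  - intros k Hk (s & Hs & Hx' & Hy'). apply level_family in Hs as (t & _ & ->).
    rewrite <- in_rev in *. apply N. apply (A_mono HR) with k; [exact I|lia|].
    apply in_chain with t; auto. now apply (A_lt Hom HX HR I) in Hx.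
Qed.

(* Counting predecessors locates [x] in any decomposition of any block containing it. *)
Lemma family_position L x s blocks R : level tau F (S L) s -> In x s ->
  decomp lt tau F (S L) s blocks R ->
  (In x R <-> length (A x (S L)) < rt tau L) /\
  forall j, j < nb tau L -> In x (blocks j) -> ~ In x R ->
    rt tau L + j * tl tau L <= length (A x (S L)) < rt tau L + S j * tl tau L.
Proof.
  intros Hs Hx (Hrtt & HlR & Hlev & Hun). apply level_family in Hs as (t & Ht & ->).
  destruct Hrtt as (H2 & NR & Hlb & Hint & HRb & Hbb).
  change (tn tau (S L)) with (nb tau L) in *. change (tr tau (S L)) with (rt tau L) in *.
  replace (S L - 1) with L in * by lia.
  destruct (tm_split Htau L) as [E1 E2].
  assert (Hpred : forall y, In y (A x (S L)) <-> In y (rev (t :: A t (S L))) /\ lt y x).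
  { intros y. rewrite <- !in_rev in *. split.
    - intros Hy. split; [now apply chain_down with x|]. now apply (A_lt Hom HX HR I) in Hy.
    - intros [Hy Hlt]. now apply in_chain with t. }
  assert (HRin : forall i y, i < nb tau L -> In y R -> In y (blocks i)).
  { intros i y Hi Hy. destruct i as [|i].
    - now apply (Hint 0 1) in Hy; [|lia|lia].
    - now apply (Hint 0 (S i)) in Hy; [|lia|lia]. }
  assert (HRs : forall y, In y R -> In y (rev (t :: A t (S L)))).
  { intros y Hy. apply Hun. exists 0. split; [lia|]. apply HRin; auto. lia. }
  assert (Hdec : forall y, In y R \/ ~ In y R) by (intros; apply classic).
  assert (HNx : NoDup (A x (S L))) by now apply (A_NoDup Hom HX HR).
  assert (HxR : In x R -> length (A x (S L)) < rt tau L).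
  { intros HxR. rewrite <- HlR. apply (@NoDup_incl_length _ (x :: A x (S L)) R).
    - apply chain_NoDup.
    - intros y [<-|Hy]; auto. apply Hpred in Hy as [Hy Hlt]. apply NNPP. intros N.
      apply Hun in Hy as (i & Hi & Hy). apply (lt_asym Hom _ _ Hlt). exact (HRb i Hi x y HxR Hy N). }
  pose (nR := fun y => if excluded_middle_informative (In y R) then false else true).
  assert (HnR : forall y l, In y (filter nR l) <-> In y l /\ ~ In y R).
  { intros y l. rewrite filter_In. unfold nR. destruct (excluded_middle_informative (In y R)); intuition congruence. }
  assert (Hbn : forall i, i < nb tau L -> NoDup (blocks i)).
  { intros i Hi. destruct (proj1 (level_family _ _) (Hlev i Hi)) as (e & _ & ->). apply NoDup_rev, chain_NoDup. }
  assert (Hlf : forall i, i < nb tau L -> length (filter nR (blocks i)) = tl tau L).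
  { intros i Hi. enough (length (R ++ filter nR (blocks i)) = length (blocks i))
      by (rewrite length_app, Hlb in H; lia).
    apply Nat.le_antisymm; apply NoDup_incl_length; auto.
    - apply NoDup_app; auto; [now apply NoDup_filter, Hbn|]. intros y Hy Hy'. now apply HnR in Hy'.
    - intros y Hy. apply in_app_or in Hy as [Hy|Hy]; [now apply HRin|now apply HnR in Hy].
    - intros y Hy. apply in_or_app. destruct (Hdec y); [now left|right]. now apply HnR. }
  (* The root with the tails of the first [j] blocks. If [x] is in the tail of block [j], its
     predecessors contain [sg j] and, together with [x], are contained in [sg (S j)]; this gives
     both bounds. *)
  pose (sg := fix sg j := match j with 0 => R | S j' => filter nR (blocks j') ++ sg j' end).
  assert (Hsg : forall j y, In y (sg j) <-> In y R \/ exists i, i < j /\ In y (blocks i) /\ ~ In y R).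
  { induction j as [|j IH]; intros y; cbn [sg].
    - split; [now left|]. intros [h|(i & h & _)]; [exact h|lia].
    - rewrite in_app_iff, IH, HnR. split.
      + intros [h|[h|(i & h & h')]]; [right; exists j; split; [lia|tauto]|now left|right; exists i; split; [lia|auto]].
      + intros [h|(i & h & h')]; [tauto|]. destruct (Nat.eq_dec i j) as [->|]; [tauto|].
        right. right. exists i. split; [lia|auto]. }
  assert (Hsl : forall j, j <= nb tau L -> length (sg j) = rt tau L + j * tl tau L /\ NoDup (sg j)).
  { induction j as [|j IH]; intros Hj; cbn [sg]; [split; [lia|exact NR]|].
    destruct IH as [IH1 IH2]; [lia|]. split.
    - rewrite length_app, Hlf, IH1 by lia. lia.
    - apply NoDup_app; auto; [apply NoDup_filter, Hbn; lia|]. intros y Hy Hy'.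
      apply HnR in Hy as [Hy N]. apply Hsg in Hy' as [h|(i & h & h' & _)]; [contradiction|].
      apply N. now apply (Hint i j); [lia|lia|]. }
  assert (Hj : forall j, j < nb tau L -> In x (blocks j) -> ~ In x R ->
    rt tau L + j * tl tau L <= length (A x (S L)) < rt tau L + S j * tl tau L).
  { intros j Hj Hxj N. split.
    - rewrite <- (proj1 (Hsl j ltac:(lia))). apply NoDup_incl_length; [apply Hsl; lia|].
      intros y Hy. apply Hpred. apply Hsg in Hy as [Hy|(i & Hi & Hy & Ny)].
      + split; auto. exact (HRb j Hj y x Hy Hxj N).
      + split; [apply Hun; exists i; split; [lia|exact Hy]|]. exact (Hbb i j Hi Hj y x Hy Ny Hxj N).
    - rewrite <- (proj1 (Hsl (S j) Hj)). apply (@NoDup_incl_length _ (x :: A x (S L))); [apply chain_NoDup|].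
      intros y [<-|Hy]; apply Hsg; [right; eauto|].
      destruct (Hdec y) as [h|h]; [now left|right]. apply Hpred in Hy as [Hy Hlt].
      apply Hun in Hy as (i & Hi & Hy). exists i. split; auto. apply Nat.nle_gt. intros Hij.
      apply (lt_asym Hom _ _ Hlt). now apply (Hbb j i). }
  split; [|exact Hj]. split; [exact HxR|]. intros Hl. apply NNPP. intros N.
  apply Hun in Hx as (j & Hj' & Hx). specialize (Hj j Hj' Hx N). nia.
Qed.

Lemma family_Xi_root L x : length (A x (S L)) < rt tau L -> Xi_is lt tau F x (S L) None.
Proof. intros H s blocks R Hs Hx Hd. now apply (family_position Hs Hx Hd). Qed.

Lemma family_Xi_block L x i : rt tau L <= length (A x (S L)) ->
  (length (A x (S L)) - rt tau L) / tl tau L = i -> Xi_is lt tau F x (S L) (Some i).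
Proof.
  intros H Hi s blocks R Hs Hx Hd. destruct (family_position Hs Hx Hd) as [H1 H2].
  assert (N : ~ In x R) by (intros h; apply H1 in h; lia).
  destruct Hd as (_ & _ & _ & Hun). apply Hun in Hx as (j & Hj & Hx).
  pose proof (H2 j Hj Hx N) as H3. replace i with j; auto.
  rewrite <- Hi. apply Nat.div_unique with (length (A x (S L)) - rt tau L - j * tl tau L); nia.
Qed.

End Scheme.

(** * Delta-systems and guessing *)

Lemma StronglySorted_app_lt (A : Type) (R : A -> A -> Prop) l l' x y :
  StronglySorted R (l ++ l') -> In x l -> In y l' -> R x y.
Proof.
  induction l as [|a l IH]; intros Hs Hx Hy; [contradiction|]. inversion Hs; subst.
  destruct Hx as [->|Hx]; auto. rewrite Forall_forall in H2. apply H2, in_or_app. now right.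
Qed.

Lemma StronglySorted_app_r (A : Type) (R : A -> A -> Prop) l l' :
  StronglySorted R (l ++ l') -> StronglySorted R l'.
Proof. induction l as [|a l IH]; auto. intros H. inversion H; auto. Qed.

Lemma countable_indexed_union (A B : Type) (Y : B -> Prop) (Q : B -> A -> Prop) :
  countable_set Y -> (forall y, Y y -> countable_set (Q y)) ->
  countable_set (fun x => exists y, Y y /\ Q y x).
Proof.
  intros [f Hf] HQ. apply countable_sub with (Q := fun x => exists i, exists y, Y y /\ f y = i /\ Q y x).
  - intros x (y & Hy & Hx). eauto.
  - apply (countable_union (fun i x => exists y, Y y /\ f y = i /\ Q y x)). intros i.
    destruct (classic (exists y, Y y /\ f y = i)) as [(y & Hy & E)|N].
    + apply countable_sub with (Q y); auto. intros x (y' & Hy' & E' & Hx).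
      rewrite (Hf y y'); congruence.
    + exists (fun _ => 0). intros x x' (y & Hy & E & _). exfalso. eauto.
Qed.

Section Delta.
Variables (T : Type) (lt : T -> T -> Prop).
Hypothesis Hom : omega1 lt.

(** Induction on the number of entries after [R]. Either some [y] prolongs [R] in uncountably many
    sets, or for each [x] only countably many sets continue [R] by an entry at most [x], and then
    some tail lies above [x]. *)
Lemma delta_extend (P : list T -> Prop) n : forall R,
  (forall s, P s -> StronglySorted lt s /\ length s = n + length R) ->
  ~ countable_set (fun s => P s /\ exists s', s = R ++ s') ->
  exists R', forall x, exists s s', P s /\ s = R' ++ s' /\ s' <> [] /\ forall y, In y s' -> lt x y.
Proof.
  induction n as [|n IH]; intros R HP HR.
  - exfalso. apply HR. exists (fun _ => 0).
    assert (H : forall s, (P s /\ exists s', s = R ++ s') -> s = R).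
    { intros s [Hs [s' E]]. destruct (HP s Hs) as [_ Hl]. rewrite E, length_app in Hl.
      destruct s'; [now rewrite E, app_nil_r|cbn in Hl; lia]. }
    intros s s' Hs Hs' _. now rewrite (H s), (H s').
  - destruct (classic (exists y, ~ countable_set (fun s => P s /\ exists s', s = (R ++ [y]) ++ s')))
      as [[y Hy]|N].
    + apply (IH (R ++ [y])); auto. intros s Hs. destruct (HP s Hs) as [h1 h2]. split; auto.
      rewrite length_app. cbn. lia.
    + exists R. intros x. apply NNPP. intros N'. apply HR.
      apply countable_sub with
        (fun s => exists y, (lt y x \/ y = x) /\ P s /\ exists s', s = (R ++ [y]) ++ s').
      * intros s [Hs [s' E]]. destruct (HP s Hs) as [h1 h2].
        destruct s' as [|y s']; [rewrite app_nil_r in E; subst; lia|].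
        exists y. split; [|split; [exact Hs|exists s'; now rewrite E, <- app_assoc]].
        apply NNPP. intros Ny. apply N'. exists s, (y :: s'). split; [exact Hs|].
        split; [exact E|]. split; [discriminate|].
        assert (Hxy : lt x y) by (destruct (o_total Hom x y) as [h|[h|h]]; auto; exfalso; auto).
        rewrite E in h1. apply StronglySorted_app_r in h1. inversion h1 as [|a b h3 h4]; subst.
        rewrite Forall_forall in h4. intros z [<-|Hz]; auto. exact (o_trans Hom _ _ _ Hxy (h4 z Hz)).
      * apply countable_indexed_union with (Q := fun y s => P s /\ exists s', s = (R ++ [y]) ++ s').
        -- apply (countable_or); [apply (countable_below Hom)|apply countable_eq].
        -- intros y _. apply NNPP. intros h. apply N. eauto.
Qed.

Lemma delta_system (P : list T -> Prop) :
  (forall s, P s -> StronglySorted lt s) -> ~ countable_set P ->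
  exists c R, forall x, exists s s', (P s /\ length s = c) /\ s = R ++ s' /\ s' <> [] /\
    forall y, In y s' -> lt x y.
Proof.
  intros HP HU.
  destruct (classic (exists c, ~ countable_set (fun s => P s /\ length s = c))) as [[c Hc]|N].
  - exists c. apply delta_extend with (n := c) (R := []).
    + intros s [h1 h2]. cbn. split; [auto|lia].
    + intros h. apply Hc. apply countable_sub with (2 := h). intros s Hs. split; [exact Hs|now exists s].
  - exfalso. apply HU. apply countable_sub with (fun s => exists c, P s /\ length s = c); [eauto|].
    apply (countable_union (fun c s => P s /\ length s = c)). intros c. apply NNPP. intros h. eauto.
Qed.

(** * Limits at which clubsuit guesses codes *)

Section Guess.
Variable Cs : T -> nat -> T.
Hypothesis HCs : forall d, is_limit lt d ->
  (forall k, lt (Cs d k) (Cs d (S k))) /\ (forall k, lt (Cs d k) d) /\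
  (forall y, lt y d -> exists k, lt y (Cs d k)).
Hypothesis HClub : forall P : T -> Prop, ~ countable_set P ->
  stationary lt (fun d => is_limit lt d /\ forall k, P (Cs d k)).
Variables (P : list T -> Prop) (R : list T).
Hypothesis HP : forall x, exists s s', P s /\ s = R ++ s' /\ s' <> [] /\ forall y, In y s' -> lt x y.

Definition good_entry (Q : T -> Prop) (d : T) (p : list T * T) : Prop :=
  Q (snd p) /\ lt (snd p) d /\ P (fst p) /\
  exists s', fst p = R ++ s' /\ s' <> [] /\ forall x, In x s' -> lt (snd p) x /\ lt x d.

(** Clubsuit is applied to the range of a function [c] sending [a] to a code above [a] of a pair
    whose ordinal is in [Q] above [a] and whose set has its tail above that ordinal. *)
Lemma guess_limit (Q : T -> Prop) : (forall x, exists g, Q g /\ lt x g) ->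
  forall x, exists d, is_limit lt d /\ lt x d /\
    (forall i, good_entry Q d (dec Hom (Cs d i))) /\
    forall y, lt y d -> exists i, lt y (snd (dec Hom (Cs d i))).
Proof.
  intros HQ x.
  assert (Hc : forall a, exists z, lt a z /\ lt a (snd (dec Hom z)) /\
    forall d, lt z d -> good_entry Q d (dec Hom z)).
  { intros a. destruct (HQ a) as (g & Hg & Hag). destruct (HP g) as (s & s' & Hs & E & Hn & Hl).
    destruct (dec_surj Hom s g a) as (z & Ez & h1 & h2 & h3). exists z. rewrite Ez. cbn.
    split; [exact h1|]. split; [exact Hag|]. intros d Hd. split; [exact Hg|]. cbn.
    split; [exact (o_trans Hom _ _ _ h2 Hd)|]. split; [exact Hs|]. exists s'. repeat split; auto.
    apply (o_trans Hom _ z _); auto. apply h3. rewrite E. apply in_or_app. now right. }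
  pose (c a := proj1_sig (constructive_indefinite_description _ (Hc a))).
  assert (Hc' : forall a, lt a (c a) /\ lt a (snd (dec Hom (c a))) /\
    forall d, lt (c a) d -> good_entry Q d (dec Hom (c a)))
    by (intros a; exact (proj2_sig (constructive_indefinite_description _ (Hc a)))).
  (* Below a [d] closed under [b], a guessed code above [b y] equals some [c a] with [a] above [y],
     so its ordinal is above [y]. Hence the guessed ordinals are cofinal. *)
  assert (Hb : forall y, exists b, forall a, (lt a y \/ a = y) -> lt (c a) b).
  { intros y. destruct (@countable_bounded T lt Hom (fun z => exists a, (lt a y \/ a = y) /\ z = c a)) as [b Hb].
    - apply countable_image with (P := fun a => lt a y \/ a = y) (g := c); [|auto].
      apply countable_or; [apply (countable_below Hom)|apply countable_eq].
    - exists b. intros a Ha. apply Hb. eauto. }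
  pose (b y := proj1_sig (constructive_indefinite_description _ (Hb y))).
  assert (Hb' : forall y a, (lt a y \/ a = y) -> lt (c a) (b y))
    by (intros y; exact (proj2_sig (constructive_indefinite_description _ (Hb y)))).
  assert (HU : ~ countable_set (fun z => exists a, z = c a)).
  { apply (not_countable_unbounded Hom). intros y. exists (c y). split; [eauto|apply Hc']. }
  destruct (HClub HU (club_closed_under Hom x b)) as (d & (Hd & Hr) & Hxd & Hbd).
  destruct (HCs Hd) as (_ & h2 & h3). exists d. split; [exact Hd|]. split; [exact Hxd|]. split.
  - intros i. destruct (Hr i) as [a E]. rewrite E. apply Hc'. rewrite <- E. apply h2.
  - intros y Hy. destruct (h3 (b y) (Hbd y Hy)) as [i Hi]. exists i. destruct (Hr i) as [a E].
    rewrite E in *. refine (o_trans Hom _ a _ _ (proj1 (proj2 (Hc' a)))).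
    destruct (o_total Hom y a) as [h|h]; auto. exfalso.
    apply (lt_asym Hom _ _ Hi). apply Hb'. destruct h as [->|h]; auto.
Qed.

End Guess.
End Delta.

(** * Capturing by the scheme *)

Section Capturing.
Variables (T : Type) (lt : T -> T -> Prop).
Hypothesis Hom : omega1 lt.
Variable Cs : T -> nat -> T.
Hypothesis HCs : forall d, is_limit lt d ->
  (forall k, lt (Cs d k) (Cs d (S k))) /\ (forall k, lt (Cs d k) d) /\
  (forall y, lt y d -> exists k, lt y (Cs d k)).
Hypothesis HClub : forall P : T -> Prop, ~ countable_set P ->
  stationary lt (fun d => is_limit lt d /\ forall k, P (Cs d k)).
Variable tau : type_seq.
Hypothesis Htau : is_type tau.
Variable cov : nat -> nat.
Hypothesis Hcov : covers tau cov.
Let dc := fun d i => dec Hom (Cs d i).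
Variable A : T -> nat -> list T.
Hypothesis HA : forall d, spec lt tau cov dc A d (A d).
Let Hrow : forall d, row lt tau cov A d (A d) := fun d => proj1 (HA d).
Let X := fun _ : T => True.
Let HR : forall x, X x -> row lt tau cov A x (A x) := fun x _ => Hrow x.
Let HX : forall x y, lt y x -> X x -> X y := fun _ _ _ _ => I.

(* For [b = 0] the codes are taken with [g] not a limit, so that [known] at [d] stays inside [P]. *)
Lemma cap_exists (P : list T -> Prop) R b :
  (forall x, exists s s', P s /\ s = R ++ s' /\ s' <> [] /\ forall y, In y s' -> lt x y) ->
  (exists M, forall k, M <= k -> b + 1 <= nb tau k) ->
  forall x, exists d, (is_limit lt d /\ (forall y, In y R -> lt y d) /\
    cap lt tau cov A d (known lt dc d) b R (A d) /\ forall s, known lt dc d s -> P s) /\ lt x d.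
Proof.
  intros HP. induction b as [|b IH]; intros Hb x; destruct (list_bounded Hom (x :: R)) as [x' Hx'].
  - destruct (@guess_limit T lt Hom Cs HCs HClub P R HP (fun g => ~ is_limit lt g)) with (x := x')
      as (d & Hd & Hxd & He & _).
    { intros y. exists (sc lt y). split; [apply (sc_not_limit Hom)|apply (lt_sc Hom)]. }
    exists d. assert (HRd : forall y, In y R -> lt y d).
    { intros y Hy. apply (o_trans Hom _ x' _); auto. apply Hx'. now right. }
    repeat split; try apply Hd; auto.
    + now apply (HA d).
    + intros s Hs. destruct Hs as [d i|d i s h].
      * apply He.
      * exfalso. now apply (He i).
    + apply (o_trans Hom _ x' _); auto. apply Hx'. now left.
  - assert (IH' : forall x, exists d, (is_limit lt d /\ (forall y, In y R -> lt y d) /\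
      cap lt tau cov A d (known lt dc d) b R (A d) /\ forall s, known lt dc d s -> P s) /\ lt x d).
    { apply IH. destruct Hb as [M HM]. exists M. intros k Hk. specialize (HM k Hk). lia. }
    destruct (@guess_limit T lt Hom Cs HCs HClub P R HP _ IH' x') as (d & Hd & Hxd & He & Hco).
    exists d. assert (HRd : forall y, In y R -> lt y d).
    { intros y Hy. apply (o_trans Hom _ x' _); auto. apply Hx'. now right. }
    split; [|apply (o_trans Hom _ x' _); auto; apply Hx'; now left].
    split; [exact Hd|]. split; [exact HRd|]. split.
    + apply (proj2 (HA d) Hd R HRd).
      * destruct Hb as [M HM]. exists M. intros k Hk. specialize (HM k Hk). lia.
      * intros y Hy. destruct (Hco y Hy) as [i Hi]. exists i.
        destruct (He i) as ((h1 & h2 & h3 & _) & h5 & h6 & s' & h7 & h8 & h9). cbn.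
        split; [auto|]. split; [exact h2|]. split; [exact h3|]. exists s'. split; [exact h7|].
        split; [exact h8|]. intros z Hz. destruct (h9 z Hz). auto.
    (* A known set is either guessed at [d], hence in [P], or known at a guessed ordinal, where the
       induction hypothesis applies. *)
    + intros s Hs. destruct Hs as [d i|d i s _ _ h].
      * apply He.
      * now apply (He i).
Qed.

(** The row of [e] gathers all the sets at level [S L], so tail points of different blocks are
    joined there; at level [L] they are not, as they lie in different blocks. Thus [rho] is exactly
    [S L], and the positions give [Xi]. *)
Lemma captured_of_blocks (Ds : nat -> list T) nn c R L e :
  2 <= nn -> nn <= nb tau L ->
  (forall y, In y R -> In y (A e (S L)) /\ length (A y (S L)) < rt tau L) ->
  (forall i, i < nn -> StronglySorted lt (Ds i) /\ length (Ds i) = c /\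
    exists s', Ds i = R ++ s' /\ s' <> [] /\ forall x, In x s' -> In x (A e (S L)) /\
      rt tau L <= length (A x (S L)) /\ (length (A x (S L)) - rt tau L) / tl tau L = i) ->
  (forall i j, i < j -> j < nn -> Ds i <> Ds j) /\
  captured lt tau (family tau A) Ds nn (S L).
Proof.
  intros Hnn HL HRt HD.
  assert (Htail : forall i x, i < nn -> In x (Ds i) -> ~ In x R -> In x (A e (S L)) /\
    rt tau L <= length (A x (S L)) /\ (length (A x (S L)) - rt tau L) / tl tau L = i).
  { intros i x Hi Hx N. destruct (HD i Hi) as (_ & _ & s' & E & _ & Hs').
    rewrite E in Hx. apply in_app_or in Hx as [Hx|Hx]; [contradiction|auto]. }
  assert (Hblk : forall i j x y, i < j -> j < nn -> In x (Ds i) -> ~ In x R -> In y (Ds j) -> ~ In y R ->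
    In x (A y (S L)) /\ ~ In x (A y L)).
  { intros i j x y Hij Hj Hx Nx Hy Ny.
    destruct (Htail i x) as (x1 & x2 & x3); [lia|auto|auto|].
    destruct (Htail j y) as (y1 & y2 & y3); auto. split.
    - apply (A_in_of_length Hom HX HR) with e; [exact I|exact y1|exact x1|]. apply Nat.nle_gt. intros h.
      pose proof (Nat.Div0.div_le_mono (length (A y (S L)) - rt tau L) (length (A x (S L)) - rt tau L) (tl tau L)).
      lia.
    - intros h. apply (in_A_block Hom Htau HX HR I) in h; [lia|exact x2]. }
  assert (HNR : forall i s' x, i < nn -> Ds i = R ++ s' -> In x s' -> ~ In x R).
  { intros i s' x Hi E Hx HxR. destruct (HD i Hi) as (Hs & _). rewrite E in Hs.
    exact (o_irrefl Hom _ (StronglySorted_app_lt Hs HxR Hx)). }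
  assert (HRin : forall i x, i < nn -> In x R -> In x (Ds i)).
  { intros i x Hi Hx. destruct (HD i Hi) as (_ & _ & s' & -> & _). apply in_or_app. now left. }
  split.
  - intros i j Hij Hj E. destruct (HD i) as (_ & _ & s' & E' & N & Hs'); [lia|].
    destruct s' as [|x s']; [congruence|].
    assert (Nx : ~ In x R) by (apply (HNR i (x :: s') x); [lia|exact E'|now left]).
    assert (Hx : In x (Ds i)) by (rewrite E'; apply in_or_app; right; now left).
    destruct (Hblk i j x x Hij Hj) as [h _]; auto; [now rewrite <- E|].
    apply (A_lt Hom HX HR I) in h. exact (o_irrefl Hom _ h).
  - split; [lia|]. split; [exact HL|]. exists R, c. split; [|split].
    + split; [exact Hnn|]. split; [|split; [|split; [|split]]].
      * destruct (HD 0) as (Hs & _ & s' & E & _); [lia|]. rewrite E in Hs.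
        assert (HN : forall l, StronglySorted lt l -> NoDup l).
        { induction 1 as [|a l Hl IHl Ha]; constructor; auto. intros h. rewrite Forall_forall in Ha.
          exact (o_irrefl Hom _ (Ha a h)). }
        apply HN in Hs. now apply NoDup_app_remove_r in Hs.
      * intros i Hi. now apply HD.
      * intros i j Hij Hj x. split.
        -- intros [Hx Hx']. apply NNPP. intros N. destruct (Hblk i j x x) as [h _]; auto.
           apply (A_lt Hom HX HR I) in h. exact (o_irrefl Hom _ h).
        -- intros Hx. split; apply HRin; auto. lia.
      * intros i Hi x y Hx Hy N. destruct (HD i Hi) as (Hs & _ & s' & E & _). rewrite E in *.
        apply in_app_or in Hy as [Hy|Hy]; [contradiction|]. exact (StronglySorted_app_lt Hs Hx Hy).
      * intros i j Hij Hj x y Hx Nx Hy Ny. destruct (Hblk i j x y) as [h _]; auto.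
        now apply (A_lt Hom HX HR I) in h.
    + intros i a x Hi Ha Hx. destruct (HD i Hi) as (_ & _ & s' & E & _ & Hs'). rewrite E in Hx. split; intros h.
      * rewrite nth_error_app1 in Hx by exact h. apply nth_error_In in Hx.
        apply (family_Xi_root Hom Htau Hrow). now apply HRt.
      * rewrite nth_error_app2 in Hx by exact h. apply nth_error_In in Hx.
        destruct (Hs' x Hx) as (_ & h2 & h3). now apply (family_Xi_block Hom Htau Hrow).
    + intros i j a x y Hij Hj h Ha Hx Hy.
      destruct (HD i) as (_ & _ & s1 & E1 & _); [lia|]. destruct (HD j) as (_ & _ & s2 & E2 & _); [lia|].
      pose proof (nth_error_In _ _ Hx) as Hx1. pose proof (nth_error_In _ _ Hy) as Hy1.
      rewrite E1, nth_error_app2 in Hx by exact h. rewrite E2, nth_error_app2 in Hy by exact h.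
      apply nth_error_In in Hx. apply nth_error_In in Hy.
      destruct (Hblk i j x y); auto.
      * apply (HNR i s1); auto. lia.
      * now apply (HNR j s2).
      * now apply (family_rho Hom Htau Hrow).
Qed.

(** A limit [d] captures [nn - 1] blocks, and a member of the family with tail above [d] fills the
    block of [d] itself. *)
Lemma family_capturing nn : 2 <= nn -> (exists M, forall k, M <= k -> nn <= tn tau k) ->
  n_rho_capturing lt tau (family tau A) nn.
Proof.
  intros Hnn [M HM] P HPs HU N.
  destruct (@delta_system T lt Hom P) as (c & R & HP); auto; [intros s Hs; now apply HPs|].
  set (P' := fun s => P s /\ length s = c) in *.
  destruct (list_bounded Hom R) as [x0 Hx0].
  destruct (@cap_exists P' R (nn - 1) HP) with (x := x0) as (d & (Hd & HRd & Hcap & Hkn) & _).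
  { exists M. intros k Hk. unfold nb. specialize (HM (S k)). lia. }
  destruct (HP d) as (D & D' & (HD & HDc) & ED & ND & HD').
  destruct (list_bounded Hom (d :: D')) as [e He].
  (* From [N'] on the row of [e] contains [d] and the tail [D'], which therefore lies in the block
     of [d]. *)
  destruct (@A_all T lt tau cov A X HR (max N M) e (d :: D') I He) as (N' & HN' & Hin).
  (* The empty state is tested at level [N'] only to force [L] beyond [N']. *)
  destruct (Hcap N' []) as (L & L0 & s' & v & Ds & (h1 & h2 & _) & (h3 & h4 & h5) & (h6 & h7) & h8).
  { apply (st_nil Htau). }
  pose proof (cov_gt Hcov L0) as Hcv.
  assert (Hde : In d (A e (S L))) by (apply (Hin (S L)); [lia|now left]).
  assert (Hpos : length (A d (S L)) = length v + rt tau L) by (rewrite h6, length_app; lia).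
  exists (S L). split; [lia|].
  exists (fun i => if i <? nn - 1 then Ds i else D). split.
  { intros i Hi. destruct (Nat.ltb_spec i (nn - 1)) as [h|h]; auto. now apply Hkn, h8. }
  apply captured_of_blocks with (c := c) (R := R) (e := e); auto.
  - unfold nb. apply HM. lia.
  - intros y Hy. apply h5 in Hy. assert (Hyd : In y (A d (S L))) by (rewrite h6; apply in_or_app; now right).
    split; [now apply (A_trans Hom HX HR) with d|].
    apply in_split in Hy as (u1 & u2 & E).
    assert (E' : A d (S L) = (v ++ u1) ++ y :: u2) by (rewrite h6, E, app_assoc; reflexivity).
    destruct (A_suffix Hom HX HR I E') as (<- & _). rewrite <- h4, E, length_app. cbn. lia.
  - intros i Hi. destruct (Nat.ltb_spec i (nn - 1)) as [h|h].
    + destruct (h8 i h) as (Hk & D'' & E & ND'' & HD''). destruct (Hkn _ Hk) as [g1 g2].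
      split; [now apply HPs|]. split; [exact g2|]. exists D''. split; [exact E|]. split; [exact ND''|].
      intros x Hx. destruct (HD'' x Hx) as (g3 & g4 & g5). split; [|exact g5].
      now apply (A_trans Hom HX HR) with d.
    + split; [now apply HPs|]. split; [exact HDc|]. exists D'. split; [exact ED|]. split; [exact ND|].
      intros x Hx. assert (Hdx : In d (A x L)).
      { apply (A_linear Hom HX HR) with e; [exact I| | |auto]; (apply (Hin L); [lia|]); [now right|now left]. }
      assert (Hdx' : In d (A x (S L))) by (apply (A_mono HR) with L; [exact I|lia|exact Hdx]).
      split; [apply (Hin (S L)); [lia|now right]|].
      apply (A_length_lt Hom HX HR I) in Hdx'. split; [lia|].
      rewrite <- (in_A_block Hom Htau HX HR I Hdx) by lia. rewrite Hpos, Nat.add_sub. lia.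
Qed.

End Capturing.

(** A single scheme serves every [nn] that is eventually a lower bound of [tn tau]; both halves of
    the theorem follow. *)
Lemma capturing_scheme (T : Type) (lt : T -> T -> Prop) (tau : type_seq) :
  omega1 lt -> clubsuit lt -> good_type tau ->
  exists F, scheme lt tau F /\ forall nn, 2 <= nn -> (exists M, forall k, M <= k -> nn <= tn tau k) ->
    n_rho_capturing lt tau F nn.
Proof.
  intros Hom (Cs & HCs & HClub) Hg. pose proof (proj1 Hg) as Htau.
  destruct (covers_exist Hg) as [cov Hcov].
  destruct (construction Hom Htau Hcov (fun d i => dec Hom (Cs d i))) as [A HA].
  exists (family tau A). split.
  - apply (family_scheme Hom Htau (cov := cov)). intros x. apply HA.
  - intros nn. now apply (family_capturing HCs HClub Htau Hcov HA).
Qed.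

Theorem mainTheorem9 :
  forall (T : Type) (lt : T -> T -> Prop),
    omega1 lt -> clubsuit lt ->
    (forall (nn : nat) (tau : type_seq),
        2 <= nn -> good_type tau ->
        (forall k, 1 <= k -> nn <= tn tau k) ->
        exists F : list T -> Prop, scheme lt tau F /\ n_rho_capturing lt tau F nn) /\
    (forall tau : type_seq,
        good_type tau ->
        (forall k, tn tau (S k) <= tn tau (S (S k))) ->
        (forall N, exists k, N <= tn tau (S k)) ->
        exists F : list T -> Prop, scheme lt tau F /\ rho_capturing lt tau F).
Proof.
  intros T lt Hom Hclub. split.
  - intros nn tau Hnn Hg Hn. destruct (capturing_scheme Hom Hclub Hg) as (F & HF & HC).
    exists F. split; [exact HF|]. apply HC; eauto.
  - intros tau Hg Hmono Hunb. destruct (capturing_scheme Hom Hclub Hg) as (F & HF & HC).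
    exists F. split; [exact HF|]. intros nn Hnn. apply HC; auto.
    destruct (Hunb nn) as [k0 Hk0]. exists (S k0). intros k Hk.
    induction Hk as [|k Hk IH]; [exact Hk0|]. destruct k as [|k]; [lia|].
    specialize (Hmono k). lia.
Qed.
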